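(* Let $\ell\ge 2$, $S=\mathbb{R}[x_1,\dots,x_\ell]$, $m=2$ and $\Lambda=\{(\lambda_1,\lambda_2)\in\mathbb{Z}^2\mid \ell-2\ge\lambda_1\ge\lambda_2\ge 0\}$. The set $$C_{\mathcal{D}}:=\{\eta^{\mathcal{D}}_i\mid i=1,\dots,\ell\}\cup\{\theta^{\mathcal{D}}_\lambda\mid\lambda\in\Lambda\}$$ forms an $S$-basis for $D^{(2)}(\mathcal{D}_\ell)$. Hence, as multisets, $$\exp D^{(2)}(\mathcal{D}_\ell)=\{\underbrace{2\ell-2,\dots,2\ell-2}_{\ell}\}\cup\{2\lambda_1+2\lambda_2-2\mid\ell-2\ge\lambda_1\ge\lambda_2\ge1\}\cup\{2\lambda_1-2+\ell\mid\ell-2\ge\lambda_1\ge1\}\cup\{2\ell-2\}.$$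
   Context: $S=\mathbb{R}[x_1,\dots,x_\ell]$, $\partial_i=\partial/\partial x_i$, and $D^{(2)}(S)=\bigoplus_{|\alpha|=2}S\,\partial^{\alpha}$ (sum over multi-indices $\alpha\in\mathbb{N}^\ell$ with $|\alpha|=\alpha_1+\cdots+\alpha_\ell=2$). A nonzero $\theta=\sum f_\alpha\partial^\alpha$ is homogeneous of degree $i$ if each $f_\alpha$ is zero or homogeneous of degree $i$. The Coxeter arrangement $\mathcal{D}_\ell$ of type D in $\mathbb{R}^\ell$ consists of the hyperplanes $\{x_i\pm x_j=0\}$, $1\le i<j\le\ell$; it has defining polynomial $Q(\mathcal{D}_\ell)=\prod_{1\le i<j\le\ell}(x_i^2-x_j^2)$, and $D^{(2)}(\mathcal{D}_\ell)=\{\theta\in D^{(2)}(S)\mid\theta(Q(\mathcal{D}_\ell)S)\subseteq Q(\mathcal{D}_\ell)S\}$. When this is a free $S$-module, $\exp D^{(2)}(\mathcal{D}_\ell)$ is the multiset of degrees of a homogeneous basis. For $|\alpha|=2$, $x_\alpha$ is the pair listing $x_i$ with multiplicity $\alpha_i$ (i.e. $(x_i,x_i)$ or $(x_i,x_j)$ with $i<j$), and $\alpha!=\alpha_1!\cdots\alpha_\ell!$. For $\lambda\in\Lambda$ define the symmetric Laurent polynomial $$s^{\mathcal{D}}_\lambda(t_1,t_2)=\frac{\det(t_i^{2(\lambda_j+2-j)-1})_{1\le i,j\le2}}{\det(t_i^{2(2-j)})_{1\le i,j\le2}}\in S[t_1^{\pm1},t_2^{\pm1}].$$ Let $\lambda^{(0)}=(0,0)$.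 Set $\theta_\lambda=\sum_{|\alpha|=2}s^{\mathcal{D}}_\lambda(x_\alpha)\frac{1}{\alpha!}\partial^\alpha$ and $$\theta^{\mathcal{D}}_\lambda=\begin{cases}\theta_\lambda&\text{if }\lambda_2\ge1,\\ (x_1\cdots x_\ell)\,\theta_\lambda&\text{if }\lambda_2=0,\ \lambda_1\geq 1,\\ (x_1\cdots x_\ell)^2\,\theta_\lambda&\text{if }\lambda=\lambda^{(0)}.\end{cases}$$ These have coefficients in $S$. For $k=1,\dots,\ell$ put $h^{\mathcal{D}}_k=\prod_{i\ne k}(x_k^2-x_i^2)$ and $$\eta^{\mathcal{D}}_k=\frac{h^{\mathcal{D}}_k}{2x_k}\partial_k^2-(-1)^{\ell-1}\frac{1}{x_k}\theta^{\mathcal{D}}_{\lambda^{(0)}},$$ which also has coefficients in $S$.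
   Formalization: The ℓ exponents coming from the η_i are 2ℓ−3 in the formal statement, not 2ℓ−2 as printed: η_k has degree 2(ℓ−1)−1 (for ℓ=2, η_1 has degree 1), so the printed multiset is false; everything else is as stated. *)

(* Defs.v *)
From HB Require Import structures.
From mathcomp Require Import all_boot all_order all_algebra.
From mathcomp Require Import boolp classical_sets reals.
From mathcomp Require Import fraction mpoly.

Set Implicit Arguments.
Unset Strict Implicit.
Unset Printing Implicit Defensive.

Import GRing.Theory.
Local Open Scope ring_scope.

Section RationalFunctions.
Variables (K : fieldType) (n : nat).
Implicit Types (p q : {mpoly K[n]}) (v : 'I_n -> K).

(* The value at v of a rational function f that is regular at v; it does not
   depend on the representation p / q (rat_evalE).  A Laurent polynomial is
   regular at every v with nonzero coordinates, and its value there is the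
   one obtained by substitution.  The default 0 is the junk value. *)
Definition rat_eval (f : {fraction {mpoly K[n]}}) (v : 'I_n -> K) : K :=
  xget 0 [set y | exists p q : {mpoly K[n]},
    [/\ f = tofrac p / tofrac q, q.@[v] != 0 & y = p.@[v] / q.@[v]]]%classic.

Lemma rat_evalE p q v :
  q.@[v] != 0 -> rat_eval (tofrac p / tofrac q) v = p.@[v] / q.@[v].
Proof.
move=> qv; rewrite /rat_eval; case: xgetP => [y _|]; last first.
  by move=> /(_ (p.@[v] / q.@[v])) []; exists p, q.
move=> [p' [q' [e q'v ->]]].
have nz r : r.@[v] != 0 -> tofrac r != 0.
  by rewrite tofrac_eq0; apply: contraNneq => ->; rewrite meval0.
move/eqP: e; rewrite eqr_div ?nz // -!tofracM tofrac_eq => /eqP e.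
by apply/eqP; rewrite eqr_div // -!mevalM e.
Qed.

(* s_lambda(t_1, t_2) for type D, with lambda = (a, b); the 0-based index
   j : 'I_2 stands for the 1-based j + 1 *)
Definition schurD (a b : nat) : {fraction {mpoly K[2]}} :=
  let t (i : 'I_2) : {fraction {mpoly K[2]}} := tofrac 'X_i in
  let lam (j : 'I_2) := nth 0%N [:: a; b] j in
  \det (\matrix_(i < 2, j < 2)
          t i ^ (2 * ((lam j)%:Z + 2 - (j.+1)%:Z) - 1))
  / \det (\matrix_(i < 2, j < 2) t i ^ (2 * (2 - (j.+1)%:Z))).

End RationalFunctions.

Definition mi2 (l : nat) := {a : 'X_{1..l < 3} | mdeg a == 2%N}.

Definition mi2_mnm (l : nat) (a : mi2 l) : 'X_{1..l} := val (val a).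
Coercion mi2_mnm : mi2 >-> multinom.

Definition mnm_fact (l : nat) (a : 'X_{1..l}) : nat := (\prod_(i < l) (a i)`!)%N.

(* dop2 R l is D^(2)(S), S = R[x_1, ..., x_l]: theta is the family of its
   coefficients f_alpha.  fdop2 R l allows coefficients in Frac S. *)
Notation dop2 R l := {ffun mi2 l -> {mpoly R[l]}^o}.
Notation fdop2 R l := {ffun mi2 l -> {fraction {mpoly R[l]}}}.

Section Operators.
Variables (R : realType) (l : nat).
Local Notation S := {mpoly R[l]}.
Local Notation F := {fraction {mpoly R[l]}}.

Definition dop_app (theta : dop2 R l) (f : S) : S :=
  \sum_(a : mi2 l) (theta a : S) * f^`M[a].

Definition D2 (Q : S) (theta : dop2 R l) : Prop :=
  forall f : S, exists g : S, dop_app theta (Q * f) = Q * g.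

(* 0 \is d.-homog holds for every d *)
Definition dop_homog (d : nat) (theta : dop2 R l) : Prop :=
  theta != 0 /\ forall a : mi2 l, (theta a : S) \is d.-homog.

Definition frac_dop (theta : dop2 R l) : fdop2 R l :=
  [ffun a => @FracField.tofrac S (theta a)].

Definition QD : S :=
  \prod_(i < l) \prod_(j < l | (i < j)%N) ('X_i ^+ 2 - 'X_j ^+ 2).

Definition xF (i : 'I_l) : F := @FracField.tofrac S 'X_i.

(* x_i listed with multiplicity alpha_i, in increasing order of i *)
Definition x_of (a : 'X_{1..l}) (j : 'I_2) : F :=
  nth 0 (flatten [seq nseq (a i) (xF i) | i <- enum 'I_l]) j.

Definition theta_ (a b : nat) : fdop2 R l :=
  [ffun al : mi2 l => rat_eval (schurD F a b) (x_of al) * (mnm_fact al)%:R^-1].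

Definition thetaD (a b : nat) : fdop2 R l :=
  let e := if (1 <= b)%N then 0%N else if (1 <= a)%N then 1%N else 2%N in
  [ffun al : mi2 l => (\prod_(i < l) xF i) ^+ e * theta_ a b al].

Definition hD (k : 'I_l) : F :=
  \prod_(i < l | i != k) (xF k ^+ 2 - xF i ^+ 2).

Definition etaD (k : 'I_l) : fdop2 R l :=
  [ffun al : mi2 l =>
     (if mi2_mnm al == (U_(k) + U_(k))%MM then hD k / (2 * xF k) else 0)
     - (-1) ^+ l.-1 * (xF k)^-1 * thetaD 0 0 al].

Definition Lam : finType :=
  {lam : 'I_l.-1 * 'I_l.-1 | (lam.2 <= lam.1)%N}.

Definition CD (c : 'I_l + Lam) : fdop2 R l :=
  match c with
  | inl k => etaD k
  | inr lam => thetaD (val lam).1 (val lam).2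
  end.

End Operators.

Definition is_basis (A : nzRingType) (M : lmodType A) (N : M -> Prop)
    (I : finType) (b : I -> M) : Prop :=
  [/\ forall i, N (b i),
      forall c : I -> A, \sum_i c i *: b i = 0 -> forall i, c i = 0
    & forall x, N x -> exists c : I -> A, x = \sum_i c i *: b i].

(* N has a homogeneous basis whose degrees are, in some order, those of s *)
Definition has_hbasis (R : realType) (l : nat) (N : dop2 R l -> Prop)
    (s : seq nat) : Prop :=
  exists b : 'I_(size s) -> dop2 R l,
    is_basis N b /\ forall i : 'I_(size s), dop_homog (nth 0%N s i) (b i).

(* exp N = s as multisets: N is free with a homogeneous basis of degrees s,
   and s is the only such multiset of degrees *)
Definition is_exp (R : realType) (l : nat) (N : dop2 R l -> Prop)
    (s : seq nat) : Prop :=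
  has_hbasis N s /\ forall s', has_hbasis N s' -> perm_eq s' s.

(* Main.v *)
(* An operator theta = sum_a f_a d^a is encoded by the Hessian G of its symbol,
   the symmetric matrix with entries G_ij = a! f_a for a = e_i + e_j.  By the
   Leibniz rule, theta preserves the ideal of Q iff x_i - e x_j divides
   G_ik - e G_jk for all i < j, all k and e = 1, -1, that is, iff all columns of
   G are logarithmic derivations of the arrangement.  These are the polynomial
   combinations of the columns u_0 = (P / x_i)_i, with P = x_1 ... x_l, and
   u_a = (x_i^(2a-1))_i, 1 <= a < l, of a matrix U: by Cramer's rule, since
   det U is the Vandermonde determinant of the x_i^2, i.e. Q up to sign.

   The Hessian of theta_lambda is U T U^T, where T has support in the rows and
   columns 0, ..., lambda_1 and the T's are unitriangular with respect to
   lambda_1.  The Hessian of eta_k is U N, where the last row of N is e_k: its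
   k-th column lists the coefficients of prod_(i != k) (t - x_i^2), the constant
   one replaced by 0.  Given G = U M, subtracting the combination of the
   eta_k prescribed by the last row of M makes this row vanish.  Modulo
   x_i - e x_j the vectors u_0, ..., u_(l-2) remain independent, so the rows of
   the new M are again logarithmic, whence G = U B U^T with B symmetric and zero
   in its last row, and such a B is a combination of the T's.  The same
   decomposition gives linear independence. *)

From HB Require Import structures.
Require Import Defs.
From mathcomp Require Import all_boot all_order all_algebra perm.
From mathcomp Require Import reals fraction mpoly ring zify.

Set Implicit Arguments.
Unset Strict Implicit.
Unset Printing Implicit Defensive.
Import GRing.Theory Num.Theory.

(** * Reduction modulo the hyperplanes x_i = ± x_j *)

Section Fold.
Local Open Scope ring_scope.
Variables (R : numFieldType) (l : nat).
Local Notation S := {mpoly R[l]}.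
Implicit Types (i j k : 'I_l) (b : bool) (p q : S).

Definition hyp i j b : S := 'X_i - (-1) ^+ b * 'X_j.

(* Substitution of (-1)^b x_j for x_i: its kernel is the prime ideal generated
   by the linear form [hyp i j b]. *)
Definition fold i j b : S -> S :=
  comp_mpoly [tuple (if k == i then (-1) ^+ b * 'X_j else 'X_k : S) | k < l].

HB.instance Definition _ i j b := GRing.LRMorphism.on (fold i j b).

Lemma foldX i j b k :
  fold i j b 'X_k = if k == i then (-1) ^+ b * 'X_j else 'X_k.
Proof. by rewrite /fold comp_mpolyXU -tnth_nth tnth_mktuple. Qed.

Lemma fold_hyp i j b : i != j -> fold i j b (hyp i j b) = 0.
Proof.
move=> ij; rewrite /hyp rmorphB rmorphM rmorph_sign /= !foldX eqxx.
by rewrite eq_sym (negbTE ij) subrr.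
Qed.

(** The polynomials congruent to their own folding are closed under sums and products and contain
    the variables. *)
Lemma fold_modulo i j b p : exists q, p = fold i j b p + hyp i j b * q.
Proof.
pose good p := exists q, p = fold i j b p + hyp i j b * q.
have goodM p1 p2 : good p1 -> good p2 -> good (p1 * p2).
  move=> [q1 e1] [q2 e2]; exists (q1 * p2 + fold i j b p1 * q2).
  by rewrite rmorphM /= {1}e1 mulrDl {1}e2; ring.
have good1 : good 1 by exists 0; rewrite rmorph1 mulr0 addr0.
have goodX k : good 'X_k.
  rewrite /good foldX; case: eqVneq => [->|_].
    by exists 1; rewrite /hyp; ring.
  by exists 0; rewrite mulr0 addr0.
have goodXm m : good 'X_[m].
  rewrite mpolyXE_id; apply: (big_ind good) => // k _.
  by elim: (m k) => [|n IHn]; rewrite ?expr0 // exprS; apply: goodM.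
elim/mpolyind: p => [|c m p _ _ [q e]].
  by exists 0; rewrite rmorph0 mulr0 addr0.
have [q' e'] := goodXm m.
exists (c *: q' + q); rewrite linearD linearZ /= {1}e {1}e'.
by rewrite scalerDr mulrDr -scalerAr; ring.
Qed.

Lemma fold0P i j b p : i != j ->
  fold i j b p = 0 <-> exists q, p = hyp i j b * q.
Proof.
move=> ij; split=> [p0|[q ->]]; last by rewrite rmorphM /= fold_hyp ?mul0r.
by have [q e] := fold_modulo i j b p; exists q; rewrite e p0 add0r.
Qed.

Lemma mpolyXU_neq0 k : 'X_k != 0 :> S.
Proof.
apply/eqP => /(congr1 (fun p => p@_U_(k))).
by rewrite mcoeffX mcoeff0 eqxx => /eqP; rewrite oner_eq0.
Qed.

Lemma signX_inj b1 b2 k1 k2 :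
  (-1) ^+ b1 * 'X_k1 = (-1) ^+ b2 * 'X_k2 :> S -> b1 = b2 /\ k1 = k2.
Proof.
have sgnE b k m : ((-1) ^+ b * 'X_k : S)@_m = (-1) ^+ b * (U_(k)%MM == m)%:R.
  by rewrite !mulr_sign; case: b; rewrite ?mcoeffN mcoeffX.
move=> /(congr1 (fun p => p@_U_(k1))); rewrite !sgnE eqxx mulr1.
rewrite eq_mnm1 eq_sym; case: eqVneq => [->|_]; last first.
  by rewrite mulr0 => /eqP; rewrite signr_eq0.
by rewrite mulr1 => /signr_inj ->.
Qed.

Lemma signX_eqX b k1 k2 : 'X_k1 = (-1) ^+ b * 'X_k2 :> S -> ~~ b /\ k1 = k2.
Proof.
rewrite -['X_k1]mul1r -[1](expr0 (-1)) -[0%N]/(nat_of_bool false).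
by move=> /signX_inj [<- ->].
Qed.

Lemma hyp_neq0 i j b : i != j -> hyp i j b != 0.
Proof. by move=> ij; rewrite subr_eq0; apply: contraNneq ij => /signX_eqX [_ ->]. Qed.

Lemma sqrX_inj : injective (fun k => 'X_k ^+ 2 : S).
Proof.
move=> k1 k2 /eqP; rewrite eqf_sqr => /orP[] /eqP.
  by rewrite -['X_k2]mul1r => /(@signX_eqX false) [].
by rewrite -mulN1r => /(@signX_eqX true) [].
Qed.

(** Since the index pairs are ordered, distinct triples give non-proportional linear forms, so none
    vanishes on the hyperplane of another. *)
Lemma fold_hyp_neq0 i j b i' j' b' : (i < j)%N -> (i' < j')%N ->
  (i, j, b) != (i', j', b') -> fold i j b (hyp i' j' b') != 0.
Proof.
move=> ij ij' ne; rewrite /hyp rmorphB rmorphM rmorph_sign /= !foldX subr_eq0.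
apply: contra ne; case: (eqVneq i' i) => [ei|ni]; case: (eqVneq j' i) => [ej|nj].
- by rewrite ei ej ltnn in ij'.
- by move=> /eqP /signX_inj [-> ->]; rewrite ei.
- rewrite mulrA -signr_addb => /eqP /signX_eqX [_ e]; rewrite e ej in ij'.
  by move: (ltn_trans ij ij'); rewrite ltnn.
- by move=> /eqP /signX_eqX [_ e]; rewrite e ltnn in ij'.
Qed.
End Fold.

(** * Logarithmic derivations of the type D arrangement and the matrix U *)

Section FirstOrder.
Local Open Scope ring_scope.
Variables (R : realType) (n : nat).
Local Notation l := n.+2.
Local Notation S := {mpoly R[l]}.
Implicit Types (i j k : 'I_l) (b : bool) (p q : S).

Lemma QD_hyp :
  QD R l = \prod_(t : 'I_l * 'I_l * bool | (t.1.1 < t.1.2)%N)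
             hyp R t.1.1 t.1.2 t.2.
Proof.
rewrite /QD pair_big_dep /=.
transitivity (\prod_(u : 'I_l * 'I_l | (u.1 < u.2)%N) \prod_b hyp R u.1 u.2 b).
  by apply: eq_bigr => -[i j] _; rewrite big_bool /hyp /= expr0 expr1; ring.
by rewrite pair_big_dep /=; apply: eq_bigl => t; rewrite andbT.
Qed.

(** Q is squarefree: the cofactor of a linear form does not vanish on its hyperplane. *)
Lemma QD_factor i j b : (i < j)%N ->
  exists2 q, QD R l = hyp R i j b * q & fold i j b q != 0.
Proof.
move=> ij; rewrite QD_hyp (bigD1 (i, j, b)) //=; eexists; first by [].
rewrite rmorph_prod; apply/prodf_neq0 => -[[i' j'] b'] /= /andP[ij' ne].
by rewrite fold_hyp_neq0 // eq_sym.
Qed.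

Lemma QD_neq0 : QD R l != 0.
Proof.
rewrite QD_hyp; apply/prodf_neq0 => -[[i j] b] /= ij.
by rewrite hyp_neq0 // -val_eqE ltn_eqF.
Qed.

(** The factors are split off one at a time: modulo the next form the product already extracted is
    nonzero, so the remaining quotient must vanish. *)
Lemma QD_dvd p : (forall i j b, (i < j)%N -> fold i j b p = 0) ->
  exists q, p = QD R l * q.
Proof.
move=> p0; rewrite QD_hyp -big_filter; set r := filter _ _.
have ur : uniq r by apply/filter_uniq/index_enum_uniq.
have: all (fun t : 'I_l * 'I_l * bool => (t.1.1 < t.1.2)%N) r by apply: filter_all.
elim: (r) ur => [|[[i j] b] r' IHr] /=; first by exists p; rewrite big_nil mul1r.
case/andP => tr ur' /andP[ij ar]; have [q e] := IHr ur' ar.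
have: fold i j b p = 0 by apply: p0.
rewrite e rmorphM rmorph_prod => /eqP; rewrite mulf_eq0 => /orP[].
  rewrite prodf_seq_eq0 => /hasP [[[i' j'] b'] tr' /= /eqP h0].
  have ne : (i, j, b) != (i', j', b') by apply: contraNneq tr => ->.
  by have := fold_hyp_neq0 R ij (allP ar _ tr') ne; rewrite h0 eqxx.
move/eqP/fold0P => [|q' ->]; first by rewrite -val_eqE neq_ltn ij.
by exists q'; rewrite big_cons /=; ring.
Qed.

(* The columns of such a matrix are the logarithmic derivations of the type D
   arrangement. *)
Definition log_mx m (A : 'M[S]_(l, m)) : Prop := forall i j b c, (i < j)%N ->
  fold i j b (A i c) = (-1) ^+ b * fold i j b (A j c).

Lemma log_mxM m1 m2 (A : 'M[S]_(l, m1)) (B : 'M[S]_(m1, m2)) :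
  log_mx A -> log_mx (A *m B).
Proof.
move=> logA i j b k ij; rewrite !mxE !rmorph_sum mulr_sumr /=.
by apply: eq_bigr => c _; rewrite !rmorphM /= (logA _ _ _ _ ij) mulrA.
Qed.

Definition xprod : S := \prod_(i < l) 'X_i.

(* Column 0 is P / x_i, and column a > 0 is x_i^(2a-1). *)
Definition umx : 'M[S]_l := \matrix_(i, a)
  if a == ord0 then \prod_(k < l | k != i) 'X_k else 'X_i ^+ (2 * a - 1).

(** Multiplying row i by x_i makes it a Vandermonde row in x_i^2, except for a factor P in column 0.
    Most computations with U pass through this form. *)
Lemma X_umx i a :
  'X_i * umx i a = (if a == ord0 then xprod else 1) * ('X_i ^+ 2) ^+ a.
Proof.
rewrite mxE; case: eqVneq => [->|a0].
  by rewrite expr0 mulr1 /xprod [RHS](bigD1 i).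
by rewrite mul1r -exprM -exprS subn1 prednK // muln_gt0 /= lt0n.
Qed.

(** By [X_umx], x_i U_ia depends on i only through x_i^2, which folding identifies with x_j^2; the
    factor x_j is then cancelled. *)
Lemma log_umx : log_mx umx.
Proof.
move=> i j b a ij; have Xj0 := mpolyXU_neq0 R j.
have ji : (j == i) = false by rewrite -val_eqE gtn_eqF.
have e : fold i j b ('X_i * umx i a) = fold i j b ('X_j * umx j a).
  rewrite !X_umx !rmorphM !rmorphXn /= !foldX eqxx ji.
  by congr (_ * _ ^+ _); rewrite exprMn sqrr_sign mul1r.
move: e; rewrite !rmorphM /= !foldX eqxx ji => e.
by apply: (mulfI Xj0); rewrite mulrCA -e !mulrA -expr2 sqrr_sign mul1r mulrC.
Qed.

Lemma det_umx : \det umx =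
  \prod_(i < l) \prod_(j < l | (i < j)%N) ('X_j ^+ 2 - 'X_i ^+ 2).
Proof.
have x0 : xprod != 0 by apply/prodf_neq0 => i _; apply: mpolyXU_neq0.
apply: (mulfI x0); pose x := \row_(i < l) ('X_i : S).
pose d := \row_(a < l) (if a == ord0 then xprod else 1 : S).
have: \det (diag_mx x *m umx) =
      \det ((Vandermonde l (map_mx (fun p => p ^+ 2) x))^T *m diag_mx d).
  by congr (\det _); apply/matrixP => i a; rewrite mul_diag_mx mul_mx_diag !mxE
    [RHS]mulrC -X_umx mxE.
rewrite !det_mulmx !det_diag det_tr det_Vandermonde.
under eq_bigr do rewrite mxE.
rewrite -/xprod => ->; rewrite mulrC; congr (_ * _).
  rewrite (bigD1 ord0) //= mxE eqxx big1 ?mulr1 // => a a0.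
  by rewrite mxE (negbTE a0).
by apply: eq_bigr => i _; apply: eq_bigr => j _; rewrite !mxE.
Qed.

Lemma det_umx_QD : exists s : nat, \det umx = (-1) ^+ s * QD R l.
Proof.
rewrite det_umx /QD !pair_big_dep /=.
under eq_bigr do rewrite -opprB -mulN1r.
by rewrite big_split /= prodr_const; eexists.
Qed.

Lemma det_umx_neq0 : \det umx != 0.
Proof. by have [s ->] := det_umx_QD; rewrite mulf_neq0 ?signr_eq0 ?QD_neq0. Qed.

Lemma umx_inj m (A : 'M[S]_(l, m)) : umx *m A = 0 -> A = 0.
Proof.
move=> e; have : \adj umx *m (umx *m A) = 0 by rewrite e mulmx0.
rewrite mulmxA mul_adj_mx mul_scalar_mx => /matrixP e'.
apply/matrixP => i j; have := e' i j; rewrite !mxE => /eqP.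
by rewrite mulf_eq0 (negbTE det_umx_neq0) => /eqP.
Qed.

Lemma log_mx_span m (A : 'M[S]_(l, m)) : log_mx A -> exists B, A = umx *m B.
Proof.
move=> logA.
have dvd (t : 'I_l * 'I_m) : exists q, (\adj umx *m A) t.1 t.2 = \det umx * q.
  case: t => a k /=.
  suff /QD_dvd [q ->] : forall i j b, (i < j)%N ->
      fold i j b ((\adj umx *m A) a k) = 0.
    have [s ->] := det_umx_QD; exists ((-1) ^+ s * q).
    by rewrite mulrACA -expr2 sqrr_sign mul1r.
  move=> i j b ij; pose U' := \matrix_(r, c) if c == a then A r k else umx r c.
  (* Cramer's rule: this entry is the determinant of U with column a replaced by column k of A. *)
  have -> : (\adj umx *m A) a k = \det U'.
    rewrite mxE (expand_det_col _ a); apply: eq_bigr => r _.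
    rewrite [\adj _ _ _]mxE [in RHS]mxE eqxx mulrC; congr (_ * (_ * \det _)).
    by apply/matrixP => r' c; rewrite !mxE [_ == a]eq_sym (negbTE (neq_lift _ _)).
  have logU' : log_mx U'.
    move=> i' j' b' c ij'; rewrite !mxE.
    by case: eqP => _; [apply: logA | have := log_umx b' c ij'; rewrite !mxE].
  (* On the hyperplane, row i of the new matrix is ± row j, so e_i ∓ e_j is in its left kernel. *)
  rewrite -det_map_mx; apply/eqP/det0P.
  exists (delta_mx 0 i - (-1) ^+ b *: delta_mx 0 j).
    apply/eqP => /matrixP/(_ 0 i); rewrite !mxE !eqxx /= -val_eqE (ltn_eqF ij).
    by rewrite mulr0 subr0 => /eqP; rewrite oner_eq0.
  apply/matrixP => z c; rewrite ord1 mulmxBl -scalemxAl -!rowE !mxE.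
  by have := logU' i j b c ij; rewrite !mxE => e; apply/eqP; rewrite subr_eq0; apply/eqP.
have [f fE] := fin_all_exists dvd.
exists (\matrix_(a, k) f (a, k)); apply/matrixP => i k; apply: (mulfI det_umx_neq0).
have : (umx *m (\adj umx *m A)) i k = (\det umx *: A) i k.
  by rewrite mulmxA mul_mx_adj mul_scalar_mx.
rewrite [in RHS]mxE => <-.
have -> : \adj umx *m A = \det umx *: \matrix_(a, k) f (a, k).
  by apply/matrixP => a k'; rewrite (fE (a, k')) !mxE.
by rewrite -scalemxAr mxE.
Qed.

(* Modulo a hyperplane, the columns of [umx] other than the last one stay
   independent: after multiplication by x_m, row m evaluates a polynomial of
   degree at most l-2 at x_m^2, and l-1 of the x_m^2 remain distinct. *)
Lemma fold_umx_inj i j b m (B : 'M[S]_(l, m)) : (i < j)%N ->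
  (forall c, B ord_max c = 0) -> map_mx (fold i j b) umx *m B = 0 -> B = 0.
Proof.
move=> ij Bmax UB0; apply/matrixP => a k; rewrite mxE.
have Px0 : fold i j b xprod != 0.
  rewrite rmorph_prod; apply/prodf_neq0 => c _ /=; rewrite foldX.
  by case: ifP => _; rewrite ?mulf_eq0 ?signr_eq0 (negbTE (mpolyXU_neq0 _ _)).
pose e (a : 'I_l) := if a == ord0 then fold i j b xprod else 1.
have e0 a' : e a' != 0 by rewrite /e; case: ifP; rewrite ?oner_eq0.
(* The weights [e] absorb the factor P of column 0; the degree bound comes from the zero last row of
   B. *)
pose Y := \poly_(a < n.+1) (e (inord a) * B (inord a) k).
have Yroot c : root Y (fold i j b 'X_c ^+ 2).
  rewrite /root horner_poly; apply/eqP.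
  have /matrixP/(_ c k) := UB0; rewrite !mxE => /(congr1 ( *%R (fold i j b 'X_c))).
  rewrite mulr0 mulr_sumr big_ord_recr /= Bmax !mulr0 addr0 => {2}<-.
  apply: eq_bigr => a' _.
  have -> : inord a' = widen_ord (leqnSn n.+1) a' by apply: val_inj; rewrite /= inordK // ltnS ltnW.
  set w := widen_ord _ _; rewrite [map_mx _ _ _ _]mxE mulrA -rmorphM /= X_umx.
  rewrite rmorphM !rmorphXn /= mulrAC; congr (_ * _ * _).
  by rewrite /e; case: eqP => // _; rewrite rmorph1.
have [lt_a|] := ltnP a n.+1; last first.
  move=> ge_a; rewrite -(Bmax k); congr (B _ _); apply: val_inj.
  by apply/eqP; rewrite eqn_leq /= ge_a -ltnS ltn_ord.
have Y0 : Y = 0.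
  apply/eqP; apply: contraT => Yn0.
  pose rs := [seq ('X_c : S) ^+ 2 | c <- enum 'I_l & c != i].
  have: (size rs < size Y)%N.
    apply: max_poly_roots => //.
      apply/allP => x /mapP [c]; rewrite mem_filter => /andP[ci _] ->.
      by have := Yroot c; rewrite foldX (negbTE ci).
    rewrite map_inj_uniq; last exact: sqrX_inj.
    by apply/filter_uniq/enum_uniq.
  rewrite size_map size_filter -sum1_count big_enum_cond /=.
  rewrite sum1_card cardC1 card_ord ltnNge /=.
  by rewrite (leq_trans (size_poly _ _)).
have := congr1 (fun p : {poly S} => p`_a) Y0; rewrite coef0 coef_poly lt_a inord_val.
by move/eqP; rewrite mulf_eq0 (negbTE (e0 a)) => /eqP.
Qed.
End FirstOrder.

(** * Multi-indices of degree 2 as unordered pairs of indices *)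

Section PairIndex.
Variable (l : nat).
Implicit Types (i j k : 'I_l) (a : mi2 l).

Lemma mdeg_mnm2 i j : mdeg (U_(i) + U_(j))%MM = 2.
Proof. by rewrite mdegD !mdeg1. Qed.

Lemma mdeg_mnm2_lt i j : (mdeg (U_(i) + U_(j))%MM < 3)%N.
Proof. by rewrite mdeg_mnm2. Qed.

Definition mi2_of i j : mi2 l :=
  exist _ (BMultinom (mdeg_mnm2_lt i j)) (introT eqP (mdeg_mnm2 i j)).

Lemma mi2_ofE i j : mi2_mnm (mi2_of i j) = (U_(i) + U_(j))%MM.
Proof. by []. Qed.

Lemma mi2_inj : injective (@mi2_mnm l).
Proof. by move=> a1 a2 e; apply/val_inj/val_inj. Qed.

Lemma mi2_ofC i j : mi2_of i j = mi2_of j i.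
Proof. by apply: mi2_inj; rewrite !mi2_ofE addmC. Qed.

(** The indices of the variables listed by [x_of]. *)
Definition xlist a : seq 'I_l := flatten [seq nseq (a i) i | i <- enum 'I_l].

Lemma size_xlist a : size (xlist a) = 2.
Proof.
rewrite size_flatten /shape -map_comp (eq_map (fun i => size_nseq (a i) i)).
rewrite sumnE big_map big_enum /= -[RHS](eqP (valP a)).
by rewrite mdegE.
Qed.

Lemma count_xlist a k : count_mem k (xlist a) = a k.
Proof.
rewrite count_flatten -map_comp sumnE big_map big_enum /= (bigD1 k) //=.
rewrite count_nseq /= eqxx mul1n big1 ?addn0 // => i ik.
by rewrite count_nseq /= (negbTE ik).
Qed.

Lemma xlistP a : exists i j, xlist a = [:: i; j] /\ a = mi2_of i j.
Proof.
have := size_xlist a; case e: (xlist a) => [|i [|j [|]]] // _.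
exists i, j; split=> //; apply: mi2_inj; apply/mnmP => k.
by rewrite -count_xlist e mi2_ofE mnmDE !mnm1E /= addn0.
Qed.

Lemma mi2_of_eq i j i' j' :
  (mi2_of i j == mi2_of i' j') = ((i, j) == (i', j')) || ((i, j) == (j', i')).
Proof.
apply/eqP/orP => [e|[/eqP [-> ->]|/eqP [-> ->]]] //; last by rewrite mi2_ofC.
have {}e : (U_(i) + U_(j) = U_(i') + U_(j'))%MM by rewrite -!mi2_ofE e.
have ei := congr1 (fun m : 'X_{1..l} => m i) e.
rewrite /= !mnmDE !mnm1E eqxx in ei.
case: (eqVneq i' i) ei => [ii' _|_].
  move: e; rewrite ii' => /addmI e; left; apply/eqP; congr (_, _).
  by apply/eqP; rewrite -eq_mnm1 e.
case: (eqVneq j' i) => // ji' _.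
move: e; rewrite ji' [X in _ = X]addmC => /addmI e; right; apply/eqP; congr (_, _).
by apply/eqP; rewrite -eq_mnm1 e.
Qed.

Lemma xlist_of i j : xlist (mi2_of i j) = [:: i; j] \/ xlist (mi2_of i j) = [:: j; i].
Proof.
have [i' [j' [-> /eqP]]] := xlistP (mi2_of i j).
by rewrite mi2_of_eq => /orP[] /eqP [-> ->]; [left | right].
Qed.

Lemma mnm_fact2 i j : mnm_fact (mi2_of i j) = if i == j then 2 else 1.
Proof.
rewrite /mnm_fact mi2_ofE; case: eqVneq => [->|ij].
  rewrite (bigD1 j) //= mnmDE mnm1E eqxx big1 ?muln1 // => k kj.
  by rewrite mnmDE mnm1E eq_sym (negbTE kj).
rewrite big1 // => k _; rewrite mnmDE !mnm1E.
by case: (eqVneq i k) ij => [->|_ _]; [move=> kj; rewrite eq_sym (negbTE kj) | case: eqP].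
Qed.

(** Two ordered pairs represent an off-diagonal index, with a! = 1, and one represents a diagonal
    index, with a! = 2. This converts sums over multi-indices into double sums. *)
Lemma mnm_fact_card a :
  (mnm_fact a * \sum_(u | mi2_of u.1 u.2 == a) 1 = 2)%N.
Proof.
have [i [j [_ ->]]] := xlistP a; rewrite mnm_fact2.
rewrite (eq_bigl (pred2 (i, j) (j, i))) => [|[i' j']]; last exact: mi2_of_eq.
by rewrite sum1_card card2 xpair_eqE (eq_sym j i); case: eqVneq.
Qed.
End PairIndex.

(** * Operators as symmetric matrices, and the second-order Leibniz rule *)

Section Hessian.
Local Open Scope ring_scope.
Variables (R : realType) (l : nat).
Local Notation S := {mpoly R[l]}.
Implicit Types (i j k : 'I_l) (b : bool) (p q f g : S) (t : dop2 R l).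

(* The Hessian of the symbol sum_a f_a xi^a; its entries are a! f_a. *)
Definition hess t : 'M[S]_l :=
  \matrix_(i, j) ((t (mi2_of i j) : S) *+ mnm_fact (mi2_of i j)).

Lemma mpoly_mulrnI m : injective (fun p : S => p *+ m.+1).
Proof.
move=> p q; rewrite -!scaler_nat => /(congr1 (fun p => m.+1%:R^-1 *: p)).
by rewrite !scalerA mulVf ?pnatr_eq0 // !scale1r.
Qed.

Lemma mnm_fact_gt0 (a : 'X_{1..l}) : (0 < mnm_fact a)%N.
Proof. by apply: prodn_gt0 => i; apply: fact_gt0. Qed.

Lemma hess_inj : injective hess.
Proof.
move=> t1 t2 e; apply/ffunP => a; have [i [j [_ ->]]] := xlistP a.
have /matrixP/(_ i j) := e; rewrite !mxE.
rewrite -(prednK (mnm_fact_gt0 _)) => e'.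
exact: mpoly_mulrnI e'.
Qed.

Lemma tr_hess t : (hess t)^T = hess t.
Proof. by apply/matrixP => i j; rewrite !mxE mi2_ofC. Qed.

Lemma hess_is_linear : linear hess.
Proof.
move=> p t1 t2; apply/matrixP => i j; rewrite !mxE !ffunE mulrnDl; congr (_ + _).
by rewrite -mulrnAr.
Qed.

HB.instance Definition _ := GRing.isLinear.Build S (dop2 R l) 'M[S]_l _ hess
  hess_is_linear.

(** The inverse of [hess] on symmetric matrices. The default 0 is never reached, by [size_xlist]. *)
Definition dop_of (G : 'M[S]_l) : dop2 R l := [ffun a : mi2 l =>
  (mnm_fact a)%:R^-1 *:
    (if xlist a is [:: i; j] then G i j else 0)].

Lemma dop_ofK (G : 'M[S]_l) : G^T = G -> hess (dop_of G) = G.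
Proof.
move=> symG; apply/matrixP => i j; rewrite mxE ffunE -scaler_nat scalerA.
rewrite mulfV ?pnatr_eq0 -?lt0n ?mnm_fact_gt0 // scale1r.
by case: (xlist_of i j) => -> //; rewrite -[in RHS]symG mxE.
Qed.

Lemma dop_app_hess t f :
  dop_app t f *+ 2 = \sum_i \sum_j hess t i j * f^`M(i)^`M(j).
Proof.
rewrite pair_big (partition_big (fun u => mi2_of u.1 u.2) xpredT) //.
rewrite /dop_app -sumrMnl; apply: eq_bigr => a _.
transitivity (\sum_(u | mi2_of u.1 u.2 == a)
    ((t a : S) *+ mnm_fact (mi2_mnm a) * f^`M[mi2_mnm a])).
  under [RHS]eq_bigr do rewrite -[_ * _]mulr1n.
  by rewrite sumrMnr mulrnAl -mulrnA mnm_fact_card.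
apply: eq_bigr => -[i j] /= /eqP <-; rewrite mxE mi2_ofE mderivmDm.
by rewrite !mderivmU1m.
Qed.

Lemma dop_appM t f g : dop_app t (f * g) = f * dop_app t g + g * dop_app t f
  + \sum_i \sum_j hess t i j * f^`M(i) * g^`M(j).
Proof.
apply: (@mpoly_mulrnI 1); rewrite !mulrnDl -!mulrnAr !dop_app_hess.
have Gsym i j : hess t i j = hess t j i by rewrite -[in LHS]tr_hess mxE.
set G := hess t in Gsym *.
(* The doubled operator produces both cross terms; symmetry of the Hessian makes them equal. *)
have eT : \sum_i \sum_j G i j * f^`M(i) * g^`M(j) =
          \sum_i \sum_j G i j * f^`M(j) * g^`M(i).
  rewrite exchange_big; apply: eq_bigr => j _; apply: eq_bigr => i _ /=.
  by rewrite Gsym.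
rewrite mulr2n {2}eT !mulr_sumr -!big_split /=.
apply: eq_bigr => i _; rewrite !mulr_sumr -!big_split /=; apply: eq_bigr => j _.
by rewrite mderivM mderivD !mderivM; ring.
Qed.
End Hessian.

(** * Preservation of the ideal of Q in terms of the Hessian *)

Section Criterion.
Local Open Scope ring_scope.
Variables (R : realType) (n : nat).
Local Notation l := n.+2.
Local Notation S := {mpoly R[l]}.
Implicit Types (i j k : 'I_l) (b : bool) (p q f g : S) (t : dop2 R l).

Lemma mderivXU k c : ('X_c : S)^`M(k) = (k == c)%:R%:MP.
Proof.
rewrite mderivX mnm1E eq_sym; case: eqVneq => [->|_].
  by rewrite -[X in (X - _)%MM]add0m addmK mpolyX0 scale1r.
by rewrite scale0r mpolyC0.
Qed.

Lemma mderiv_hyp i j b k :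
  (hyp R i j b)^`M(k) = ((k == i)%:R - (-1) ^+ b * (k == j)%:R)%:MP.
Proof.
have -> : hyp R i j b = 'X_i - ((-1) ^+ b)%:MP * 'X_j.
  by rewrite /hyp rmorph_sign.
by rewrite mderivB mderiv_mulC !mderivXU -mpolyCM -mpolyCB.
Qed.

Lemma sum_mderiv_hyp t i j b k :
  \sum_r hess t r k * (hyp R i j b)^`M(r) =
  hess t i k - (-1) ^+ b * hess t j k.
Proof.
under eq_bigr => r _ do rewrite mderiv_hyp mpolyCB mulrBr.
rewrite sumrB (bigD1 i) //= eqxx mulr1 big1 ?addr0; last first.
  by move=> r /negbTE ->; rewrite mulr0.
rewrite (bigD1 j) //= eqxx big1 ?addr0; last first.
  by move=> r /negbTE ->; rewrite mulr0 mpolyC0 mulr0.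
by rewrite mulr1 rmorph_sign mulrC.
Qed.

Lemma dop_app_hyp t i j b : dop_app t (hyp R i j b) = 0.
Proof.
apply: (@mpoly_mulrnI R l 1); rewrite mul0rn dop_app_hess.
rewrite big1 // => r _; rewrite big1 // => s _.
by rewrite mderiv_hyp mderivC mulr0.
Qed.

Lemma D2_log t : D2 (QD R l) t <-> log_mx (hess t).
Proof.
split=> [Dt i j b k ij|logt f].
  have [q Qq q0] := QD_factor R b ij.
  (* Testing on 1 and x_k isolates the cross term of the Leibniz rule for Q and x_k, the pairing of
     column k with the gradient of Q. Modulo one linear form, only the derivative of that form
     contributes to it. *)
  have [g1 e1] := Dt 1; have [g2 e2] := Dt 'X_k.
  have e : \sum_r hess t r k * (QD R l)^`M(r) =
           QD R l * (g2 - dop_app t 'X_k - 'X_k * g1).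
    rewrite mulrBr mulrBr -e2 mulrCA -e1 mulr1 dop_appM.
    rewrite [X in _ = _ + _ + X - _ - _](eq_bigr (fun r => hess t r k * (QD R l)^`M(r))).
      by ring.
    move=> r _; rewrite (bigD1 k) //= big1 ?addr0 => [|s sk].
      by rewrite mderivXU eqxx mulr1.
    by rewrite mderivXU (negbTE sk) mulr0.
  have ne : i != j by rewrite -val_eqE ltn_eqF.
  have e' : \sum_r hess t r k * (QD R l)^`M(r) =
      (\sum_r hess t r k * (hyp R i j b)^`M(r)) * q
      + hyp R i j b * \sum_r hess t r k * q^`M(r).
    rewrite Qq mulr_suml mulr_sumr -big_split; apply: eq_bigr => r _ /=.
    by rewrite mderivM; ring.
  move: e; rewrite e' {1}Qq -mulrA sum_mderiv_hyp => /(congr1 (fold i j b)).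
  rewrite rmorphD !rmorphM /= fold_hyp // !mul0r addr0 => /eqP.
  rewrite mulf_eq0 (negbTE q0) orbF rmorphB rmorphM rmorph_sign subr_eq0.
  by move/eqP.
apply: QD_dvd => i j b ij; have [q -> _] := QD_factor R b ij.
have ne : i != j by rewrite -val_eqE ltn_eqF.
(* Leibniz for the linear form times q f: the operator kills the form, so only the cross term
   survives on the hyperplane. *)
rewrite -mulrA dop_appM dop_app_hyp mulr0 addr0 rmorphD rmorphM /= fold_hyp // mul0r add0r.
rewrite exchange_big rmorph_sum big1 //= => s _.
rewrite -mulr_suml sum_mderiv_hyp rmorphM rmorphB rmorphM rmorph_sign /=.
by rewrite (logt _ _ _ _ ij) subrr mul0r.
Qed.
End Criterion.

(** * The two-variable Schur polynomials of type D *)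

Section Schur.
Local Open Scope ring_scope.

(** For b <= a this is the ordinary Schur polynomial s_(a,b)(x, y). *)
Definition hsum (A : comNzRingType) (x y : A) (a b : nat) : A :=
  \sum_(b <= c < a.+1) x ^+ c * y ^+ (a + b - c).

Lemma hsum_ord (A : comNzRingType) (x y : A) (a b m : nat) : (a < m)%N ->
  hsum x y a b = \sum_(c < m | (b <= c <= a)%N) x ^+ c * y ^+ (a + b - c).
Proof.
move=> am; rewrite /hsum (big_nat_widen _ _ _ _ _ am) big_geq_mkord.
by apply: eq_bigl => c; rewrite /= ltnS andbC.
Qed.

Lemma mul_subr_hsum (A : comNzRingType) (x y : A) (a b : nat) : (b <= a)%N ->
  (x - y) * hsum x y a b = x ^+ a.+1 * y ^+ b - x ^+ b * y ^+ a.+1.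
Proof.
move=> ba; pose f c := x ^+ c * y ^+ ((a + b).+1 - c).
transitivity (\sum_(b <= c < a.+1) (f c.+1 - f c)).
  rewrite /hsum mulr_sumr; apply: eq_big_nat => c /andP[_ ca].
  rewrite /f subSS subSn; last by lia.
  by rewrite !exprS; ring.
rewrite telescope_sumr; last by lia.
rewrite /f; congr (_ * _ ^+ _ - _ * _ ^+ _); lia.
Qed.

Lemma schur_hsum (L : fieldType) (a b : nat) (t : 'I_2 -> L) :
  (b <= a)%N -> (forall i, t i != 0) -> t 0 ^+ 2 - t 1 ^+ 2 != 0 ->
  let lam (j : 'I_2) := nth 0%N [:: a; b] j in
  \det (\matrix_(i < 2, j < 2) t i ^ (2 * ((lam j)%:Z + 2 - (j.+1)%:Z) - 1))
  / \det (\matrix_(i < 2, j < 2) t i ^ (2 * (2 - (j.+1)%:Z)))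
  = hsum (t 0 ^+ 2) (t 1 ^+ 2) a b / (t 0 * t 1).
Proof.
move=> ba t0 t01 lam.
(* The odd exponents leave a factor 1 / t_i in each row, and otherwise a bialternant in the squares
   t_i^2. *)
have e1 c d : (c%:Z = d)%R -> forall i, t i ^ (2 * d - 1) = (t i ^+ 2) ^+ c / t i.
  by move=> <- i; rewrite expfzDr // -exprM exprN1 -PoszM.
rewrite !(expand_det_row _ 0) !big_ord_recl !big_ord0 /cofactor.
rewrite !det_mx11 !mxE /= !(e1 a.+1 (a%:Z + 2 - 1)); try lia.
rewrite !(e1 b (b%:Z + 2 - 2)); try lia.
have -> : lift 0 0 = 1 :> 'I_2 by apply: val_inj.
have e2 (x : L) : x ^ (2 * (2 - 1%:Z)) = x ^+ 2 by [].
have e3 (x : L) : x ^ (2 * (2 - 2%:Z)) = 1 by [].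
rewrite !e2 !e3 /bump /= expr1 !expr0 !addr0 !mul1r mulr1 !mulN1r.
apply: (mulfI t01); rewrite [RHS]mulrA mul_subr_hsum //.
have := t0 0; have := t0 1; move: t01; set x := t 0; set y := t 1 => xy x0 y0.
by field; rewrite x0 y0 xy.
Qed.

Lemma schurD_eval (K : fieldType) (a b : nat) (v : 'I_2 -> K) :
  (b <= a)%N -> v 0 != 0 -> v 1 != 0 ->
  rat_eval (schurD K a b) v = hsum (v 0 ^+ 2) (v 1 ^+ 2) a b / (v 0 * v 1).
Proof.
move=> ba v0 v1; pose p : {mpoly K[2]} := hsum ('X_0 ^+ 2) ('X_1 ^+ 2) a b.
have -> : schurD K a b = tofrac p / tofrac ('X_0 * 'X_1 : {mpoly K[2]}).
  rewrite /schurD schur_hsum // => [|i|].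
  - rewrite tofracM /p /hsum rmorph_sum; congr (_ / _).
    by apply: eq_bigr => c _; rewrite /= tofracM !tofracXn.
  - rewrite tofrac_eq0; apply/eqP => /(congr1 (fun p => p@_U_(i))).
    by rewrite mcoeffX mcoeff0 eqxx => /eqP; rewrite oner_eq0.
  - rewrite -!tofracXn -tofracB tofrac_eq0 subr_eq0.
    apply/eqP => /(congr1 (fun p => p.@[fun i => (i == 0)%:R])).
    rewrite !rmorphXn /= !mevalXU /= expr1n expr0n /= => /eqP.
    by rewrite oner_eq0.
rewrite rat_evalE; last by rewrite mevalM !mevalXU mulf_neq0.
rewrite mevalM !mevalXU /p /hsum raddf_sum /=; congr (_ / _).
by apply: eq_bigr => c _; rewrite mevalM !rmorphXn /= !mevalXU.
Qed.
End Schur.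

(** * Hessians of eta_k and theta_lambda as polynomial matrices *)

Section Elements.
Local Open Scope ring_scope.
Variables (R : realType) (n : nat).
Local Notation l := n.+2.
Local Notation S := {mpoly R[l]}.
Implicit Types (i j k : 'I_l).
Local Notation P := (xprod R n).
Local Notation U := (umx R n).

Definition hpoly k : {poly S} := \prod_(c < l | c != k) ('X - ('X_c ^+ 2)%:P).

Lemma hpoly_seq k : hpoly k =
  \prod_(y <- [seq ('X_c : S) ^+ 2 | c <- enum (predC1 k)]) ('X - y%:P).
Proof. by rewrite big_map big_enum. Qed.

Lemma size_hpoly k : size (hpoly k) = l.
Proof. by rewrite hpoly_seq size_prod_XsubC size_map -cardE cardC1 card_ord. Qed.

Lemma hpoly_lead k : (hpoly k)`_n.+1 = 1.
Proof.
have /monicP := monic_prod_XsubC [seq ('X_c : S) ^+ 2 | c <- enum (predC1 k)] xpredT id.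
by rewrite -hpoly_seq lead_coefE size_hpoly.
Qed.

Lemma hpoly_coef0 k :
  (hpoly k)`_0 = (-1) ^+ n.+1 * \prod_(c < l | c != k) 'X_c ^+ 2.
Proof.
rewrite -horner_coef0 /hpoly horner_prod.
under eq_bigr do rewrite hornerXsubC sub0r.
by rewrite prodrN cardC1 card_ord.
Qed.

Lemma hpoly_horner k i : (hpoly k).['X_i ^+ 2] =
  (if i == k then \prod_(c < l | c != k) ('X_k ^+ 2 - 'X_c ^+ 2) else 0).
Proof.
rewrite /hpoly horner_prod; under eq_bigr do rewrite hornerXsubC.
case: eqVneq => [->|ik] //.
by rewrite (bigD1 i) //= subrr mul0r.
Qed.

(* Column k holds the coefficients of prod_(c != k) (t - x_c^2), without the
   constant one; the other columns are P / (x_k x_j) in row 0, up to sign. *)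
Definition etaN k : 'M[S]_l := \matrix_(a, j)
  if j == k then (if a == ord0 then 0 else (hpoly k)`_a)
  else if a == ord0 then - ((-1) ^+ n.+1 * \prod_(c < l | (c != k) && (c != j)) 'X_c)
  else 0.

Definition etaM k : 'M[S]_l := U *m etaN k.

Lemma etaN_max k j : etaN k ord_max j = (j == k)%:R.
Proof. by rewrite mxE -val_eqE /= hpoly_lead; case: eqP. Qed.

(** The Hessian of eta_k with denominators cleared. In column k, U evaluates at x_i^2 the polynomial
    [hpoly k] without its constant coefficient; x_k^2 times that coefficient is (-1)^(l-1) P^2. *)
Lemma X3_etaM k i j : 'X_k * 'X_i * 'X_j * etaM k i j =
  (if (i == k) && (j == k) then
     'X_k ^+ 2 * \prod_(c < l | c != k) ('X_k ^+ 2 - 'X_c ^+ 2) else 0)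
  - (-1) ^+ n.+1 * P ^+ 2.
Proof.
have PE c : P = 'X_c * \prod_(c' < l | c' != c) 'X_c' by rewrite /xprod (bigD1 c).
rewrite mxE big_ord_recl !mxE /=; case: (eqVneq j k) => [->|jk].
  rewrite mulr0 add0r andbT.
  transitivity ('X_k ^+ 2 * ((hpoly k).['X_i ^+ 2] - (hpoly k)`_0)).
    rewrite (horner_coef_wide _ (eq_leq (size_hpoly k))) [in RHS]big_ord_recl /= expr0 mulr1.
    rewrite [X in X - _]addrC addrK ['X_k * 'X_i * 'X_k]mulrAC -expr2 -mulrA; congr (_ * _).
    rewrite mulr_sumr; apply: eq_bigr => a _.
    by rewrite [in LHS]mulrA X_umx mxE eqxx /= mul1r mulrC.
  rewrite hpoly_horner hpoly_coef0 (PE k) prodrXl.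
  by case: ifP => _; ring.
rewrite andbF sub0r [X in _ + X]big1 => [|a _]; last by rewrite !mxE (negbTE jk) mulr0.
have Pkj : P = 'X_k * ('X_j * \prod_(c < l | (c != k) && (c != j)) 'X_c).
  by rewrite (PE k) (bigD1 j).
by rewrite addr0 [P ^+ 2]expr2 {1}(PE i) Pkj; ring.
Qed.

Lemma tr_etaM k : (etaM k)^T = etaM k.
Proof.
apply/matrixP => i j; rewrite mxE.
have X0 : 'X_k * 'X_i * 'X_j != 0 :> S by rewrite !mulf_neq0 ?mpolyXU_neq0.
by apply: (mulfI X0); rewrite X3_etaM ['X_k * _ * _]mulrAC X3_etaM andbC.
Qed.

(* The expansion of P^e s_(a,b)(x_i, x_j) along the products U_ic U_jd. *)
Definition thetaT (a b : nat) : 'M[S]_l := \matrix_(c, d)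
  if [&& (c + d == a + b)%N, (b <= c)%N & (c <= a)%N] then
    (if [&& (b == 0)%N, (0 < c)%N & (c < a)%N] then P else 1) else 0.

Definition thetaM (a b : nat) : 'M[S]_l := U *m thetaT a b *m U^T.

Lemma tr_thetaT a b : (thetaT a b)^T = thetaT a b.
Proof.
apply/matrixP => c d; rewrite !mxE (addnC d).
case: eqVneq => //= e.
have -> : ((b <= d) && (d <= a))%N = ((b <= c) && (c <= a))%N by lia.
case: ifP => // /andP[bc ca].
by have -> : [&& b == 0, 0 < d & d < a]%N = [&& b == 0, 0 < c & c < a]%N by lia.
Qed.

Lemma tr_thetaM a b : (thetaM a b)^T = thetaM a b.
Proof. by rewrite /thetaM !trmx_mul trmxK tr_thetaT mulmxA. Qed.

(** The antidiagonal c + d = a + b of [thetaT] reproduces the terms of [hsum], since x_i x_j U_ic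
    U_jd is x_i^(2c) x_j^(2d) up to powers of P. *)
Lemma X2_thetaM a b i j : (b <= a <= n)%N -> 'X_i * 'X_j * thetaM a b i j =
  P ^+ (if (1 <= b)%N then 0 else if (1 <= a)%N then 1 else 2)
  * hsum ('X_i ^+ 2) ('X_j ^+ 2) a b.
Proof.
case/andP=> ba an; have al : (a < l)%N by lia.
rewrite (hsum_ord _ _ _ al) mulr_sumr big_mkcond /=.
rewrite /thetaM -mulmxA mxE mulr_sumr; apply: eq_bigr => c _.
rewrite mulrACA X_umx mxE mulr_sumr.
case: (boolP (b <= c <= a)%N) => [/andP[bc ca]|/negbTE bca]; last first.
  by rewrite big1 ?mulr0 // => d _; rewrite mxE bca andbF mul0r mulr0.
have dl : (a + b - c < l)%N by lia.
rewrite (bigD1 (Ordinal dl)) //= big1 ?addr0 => [|d dd]; last first.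
  rewrite mxE; case: eqP => [e|]; last by rewrite mul0r mulr0.
  by case/eqP: dd; apply: val_inj => /=; lia.
rewrite mxE /= subnKC; last by lia.
rewrite eqxx bc ca /= [U^T _ _]mxE ['X_j * _]mulrCA X_umx /=.
set ec := if c == ord0 then _ else _; set ed := if _ == ord0 then _ else _.
set e := if _ then P else 1; set e' := (if (0 < b)%N then _ else _).
(* Each zero index contributes one P through U. For b = 0 < a this happens exactly at the two ends
   of the antidiagonal, and [thetaT] supplies the missing P in between. *)
suff <- : ec * e * ed = P ^+ e' by ring.
rewrite /ec /e /ed /e' -!val_eqE /= subn_eq0.
case: (posnP b) => [b0|b0].
  rewrite b0 in bc ca an ba *; rewrite addn0 /=.
  case: (posnP a) => [a0|a0].
    have -> : c = 0 :> nat by lia.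
    by rewrite a0 /= mulr1 expr2.
  case: (posnP c) => [c0|c0] /=; first by rewrite c0 leqNgt a0 /= !mulr1 expr1.
  by case: (ltnP c a) => ca' /=; rewrite ?mul1r ?mulr1 ?expr1.
have -> : ((c : nat) == 0)%N = false by lia.
have -> : (a + b <= c)%N = false by lia.
by rewrite /= !mulr1.
Qed.
End Elements.

(** * Identification with the rational family of the statement *)

Section Family.
Local Open Scope ring_scope.
Variables (R : realType) (n : nat).
Local Notation l := n.+2.
Local Notation S := {mpoly R[l]}.
Local Notation F := {fraction {mpoly R[l]}}.
Local Notation P := (xprod R n).
Local Notation U := (umx R n).
Local Notation xF := (@xF R l).
Implicit Types (i j k : 'I_l) (lam : Lam l).

Lemma Lam_le lam : ((val lam).2 <= (val lam).1 <= n)%N.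
Proof. by rewrite (valP lam) -ltnS ltn_ord. Qed.

Definition basisM (c : 'I_l + Lam l) : 'M[S]_l :=
  match c with
  | inl k => etaM R k
  | inr lam => thetaM R n (val lam).1 (val lam).2
  end.

Definition basisC (c : 'I_l + Lam l) : dop2 R l := dop_of (basisM c).

Lemma hess_basisC c : hess (basisC c) = basisM c.
Proof. by apply: dop_ofK; case: c => c; [apply: tr_etaM | apply: tr_thetaM]. Qed.

Lemma xF_neq0 i : xF i != 0.
Proof. by rewrite tofrac_eq0 mpolyXU_neq0. Qed.

Lemma x_ofE (a : mi2 l) i j : xlist a = [:: i; j] ->
  x_of R a 0 = xF i /\ x_of R a 1 = xF j.
Proof.
move=> e; have -> : x_of R a = nth 0 (map xF (xlist a)).
  rewrite /x_of /xlist map_flatten -map_comp; congr (fun s => nth 0 (flatten s)).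
  by apply: eq_map => c /=; rewrite map_nseq.
by rewrite e.
Qed.

Lemma tofrac_scaleV m (p : S) :
  tofrac (m.+1%:R^-1 *: p) = tofrac p / m.+1%:R :> F.
Proof.
have m0 : m.+1%:R != 0 :> F.
  by rewrite -(rmorph_nat (@tofrac S)) tofrac_eq0 -mpolyC_nat mpolyC_eq0 pnatr_eq0.
apply: (mulIf m0); rewrite mulfVK // -(rmorph_nat (@tofrac S)) -tofracM.
by rewrite mulr_natr -scaler_nat scalerA mulfV ?pnatr_eq0 // scale1r.
Qed.

Lemma thetaD_eval a b (al : mi2 l) i j : (b <= a)%N -> xlist al = [:: i; j] ->
  thetaD R l a b al =
  (\prod_(c < l) xF c) ^+ (if (1 <= b)%N then 0 else if (1 <= a)%N then 1 else 2)
  * (hsum (xF i ^+ 2) (xF j ^+ 2) a b / (xF i * xF j)) / (mnm_fact al)%:R.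
Proof.
move=> ba /x_ofE [e0 e1]; rewrite !ffunE mulrA; congr (_ * _ / _).
by rewrite schurD_eval ?e0 ?e1 ?xF_neq0.
Qed.

Lemma tofrac_hsum (x y : S) a b :
  tofrac (hsum x y a b) = hsum (tofrac x) (tofrac y) a b.
Proof.
rewrite /hsum rmorph_sum; apply: eq_bigr => c _ /=.
by rewrite tofracM !tofracXn.
Qed.

Lemma eta_frac (L : fieldType) (xk xi xj s p e u : L) :
  xk != 0 -> xi != 0 -> xj != 0 -> 
  xk * xi * xj * e = u - s * p ^+ 2 ->
  e = u / (xk * xi * xj) - s * xk^-1 * (p ^+ 2 * (1 / (xi * xj))).
Proof.
move=> k0 i0 j0 E.
have -> : e = (xk * xi * xj * e) / (xk * xi * xj) by field; rewrite k0 i0 j0.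
by rewrite E; field; rewrite k0 i0 j0.
Qed.

Lemma sqr_cancel (L : fieldType) (x h : L) :
  x != 0 -> x ^+ 2 * h / (x * x * x) = h / x.
Proof. by move=> x0; field. Qed.

Lemma theta_frac (L : fieldType) (x e p h : L) :
  x != 0 -> x * e = p * h -> e = p * (h / x).
Proof. by move=> x0 E; rewrite mulrA -E mulrC mulKf. Qed.

Lemma frac_basisC c : frac_dop (basisC c) = CD R c.
Proof.
have PE : tofrac P = \prod_(c < l) xF c by rewrite rmorph_prod.
apply/ffunP => al; rewrite !ffunE.
have [i [j [e al_ij]]] := xlistP al; rewrite e.
have fact_gt0 := mnm_fact_gt0 (mi2_mnm al).
rewrite -(prednK fact_gt0) tofrac_scaleV.
have i0 := xF_neq0 i; have j0 := xF_neq0 j.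
case: c => [k|lam] /=.
  have k0 := xF_neq0 k.
  rewrite ffunE (thetaD_eval _ e) //= /hsum big_nat1 !expr0 mulr1.
  have /(congr1 (@tofrac S)) := X3_etaM R k i j.
  rewrite tofracM tofracB !tofracM PE !tofracXn tofracN tofrac1 -!/(xF _) -expr2.
  move=> E; rewrite (eta_frac k0 i0 j0 E).
  rewrite (prednK fact_gt0) mulrBl; congr (_ - _); last first.
    by rewrite -!mulrA.
  have -> : (mi2_mnm al == (U_(k) + U_(k))%MM) = (i == k) && (j == k).
    rewrite al_ij -xpair_eqE -(orbb ((i, j) == (k, k))) -mi2_of_eq.
    by rewrite -(inj_eq (@mi2_inj l)).
  case: ifP => [/andP[/eqP ik /eqP jk]|_]; last by rewrite rmorph0 !mul0r.
  (* Here a! = 2, which accounts for the 2 in the denominator of h_k / (2 x_k). *)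
  rewrite al_ij mnm_fact2 ik jk eqxx tofracM tofracXn rmorph_prod -/(xF k).
  under eq_bigr do rewrite /= tofracB !tofracXn -/(xF _) -/(xF _).
  rewrite -/(hD R k); move: k0; move: (xF k) (hD R k) => x h x0.
  by rewrite [2 * x]mulrC sqr_cancel // invfM mulrA.
have /andP[ba an] := Lam_le lam.
rewrite (thetaD_eval _ e) // (prednK fact_gt0); congr (_ / _).
have /(congr1 (@tofrac S)) := X2_thetaM R i j (Lam_le lam).
rewrite !tofracM tofracXn PE tofrac_hsum !tofracXn -/(xF i) -/(xF j) => e'.
exact: theta_frac (mulf_neq0 i0 j0) e'.
Qed.
End Family.

(** * Independence and spanning *)

Section Basis.
Local Open Scope ring_scope.
Variables (R : realType) (n : nat).
Local Notation l := n.+2.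
Local Notation S := {mpoly R[l]}.
Local Notation U := (umx R n).
Implicit Types (i j k : 'I_l) (lam : Lam l).

Local Notation T lam := (thetaT R n (val lam).1 (val lam).2).

Lemma thetaT_neq0 lam (c d : 'I_l) :
  T lam c d != 0 -> (c + d = (val lam).1 + (val lam).2)%N /\ (c <= (val lam).1)%N.
Proof.
rewrite mxE; case: ifP => [/and3P[/eqP -> _ ->] //|_].
by rewrite eqxx.
Qed.

(** The ends of the antidiagonal carry no factor P, so this leading entry is a unit. *)
Lemma thetaT_diag lam (c d : 'I_l) :
  c = (val lam).1 :> nat -> d = (val lam).2 :> nat -> T lam c d = 1.
Proof.
move=> ec ed; have /andP[ba _] := Lam_le lam.
by rewrite mxE -ec -ed eqxx leqnn ltnn !andbF ec ed ba.
Qed.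

Lemma thetaT_max lam d : T lam ord_max d = 0.
Proof.
apply/eqP; apply: contraT => /thetaT_neq0 [_] /=.
by have /andP[_] := Lam_le lam; rewrite /= -ltnS; lia.
Qed.

Lemma Lam_eq lam1 lam2 : (val lam1).1 = (val lam2).1 :> nat ->
  (val lam1).2 = (val lam2).2 :> nat -> lam1 = lam2.
Proof.
case: lam1 lam2 => [[a b] ?] [[a' b'] ?] /= ea eb; apply: val_inj => /=.
by congr (_, _); apply: val_inj.
Qed.

(** Take lambda with nonzero coefficient and lambda_1 maximal. Another matrix that is nonzero at
    entry (lambda_1, lambda_2) has the same sum of parts and a first part at least lambda_1, hence
    the same lambda. *)
Lemma thetaT_free (c : Lam l -> S) :
  \sum_lam c lam *: T lam = 0 -> forall lam, c lam = 0.
Proof.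
move=> c0 lam0; apply/eqP; apply: contraT => cn0.
have [lam /= cl lmax] := arg_maxnP (P := fun lam => c lam != 0)
  (fun lam : Lam l => (val lam).1 : nat) cn0.
have la m : (m < n.+1)%N -> (m < l)%N by exact: ltnW.
have /matrixP/(_ (Ordinal (la _ (ltn_ord (val lam).1))) (Ordinal (la _ (ltn_ord (val lam).2)))) := c0.
rewrite mxE summxE (bigD1 lam) //= big1 ?addr0 => [|lam' ne].
  by rewrite mxE thetaT_diag // mulr1 => e; rewrite e eqxx in cl.
rewrite mxE; apply/eqP; rewrite mulf_eq0; apply: contraT; rewrite negb_or => /andP[cl'].
move=> /thetaT_neq0 /= [e1 e2]; case/eqP: ne.
have := lmax _ cl'; move: e1 e2 => /= e1 e2 e3; apply: Lam_eq => /=; lia.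
Qed.

Lemma thetaT_span (B : 'M[S]_l) : B^T = B -> (forall d, B ord_max d = 0) ->
  exists c : Lam l -> S, B = \sum_lam c lam *: T lam.
Proof.
move=> symB Bmax.
suff gen m (B' : 'M[S]_l) : (m <= n.+1)%N -> B'^T = B' ->
    (forall c d : 'I_l, (m <= c)%N -> B' c d = 0) ->
    exists c : Lam l -> S, B' = \sum_lam c lam *: T lam.
  apply: (gen n.+1) => // c d nc; rewrite -(Bmax d); congr (B _ _).
  by apply: val_inj => /=; have := ltn_ord c; lia.
elim: m {B symB Bmax} B' => [|m IHm] B mn symB Bz.
  exists (fun=> 0); rewrite big1 => [|lam _]; last by rewrite scale0r.
  by apply/matrixP => c d; rewrite mxE Bz.
(* Row m is cleared with the matrices for (m, d), d <= m, which meet it in column d only; column m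
   follows by symmetry. *)
pose e lam := if (val lam).1 == m :> nat then B (inord m) (inord (val lam).2) else 0.
pose B' := B - \sum_lam e lam *: T lam.
have symB' : B'^T = B'.
  rewrite /B' linearB /= symB raddf_sum; congr (_ - _); apply: eq_bigr => lam _.
  by rewrite /= linearZ /= tr_thetaT.
have B'z (c d : 'I_l) : (m <= c)%N -> B' c d = 0.
  move=> mc; rewrite mxE [X in _ + X]mxE summxE.
  have [dm|md] := leqP d m; last first.
    rewrite -[in B c d]symB mxE Bz // sub0r big1 ?oppr0 // => lam _.
    rewrite mxE /e; case: eqP => [em|_]; last by rewrite mul0r.
    apply/eqP; rewrite mulf_eq0; apply: contraT; rewrite negb_or => /andP[_].
    move=> /thetaT_neq0 [e1 e2]; have /andP[e3 _] := Lam_le lam.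
    by move: em e1 e2 e3 => /=; lia.
  move: mc; rewrite leq_eqVlt => /orP[/eqP mc|mc]; last first.
    rewrite Bz // sub0r big1 ?oppr0 // => lam _.
    rewrite mxE /e; case: eqP => [em|_]; last by rewrite mul0r.
    apply/eqP; rewrite mulf_eq0; apply: contraT; rewrite negb_or => /andP[_].
    by move=> /thetaT_neq0 [e1 e2]; move: em e1 e2 => /=; lia.
  have dn : (d < n.+1)%N by lia.
  have ledm : ((Ordinal dn : 'I_l.-1) <= (Ordinal mn : 'I_l.-1))%N by [].
  pose lam0 : Lam l := exist _ (Ordinal mn, Ordinal dn) ledm.
  rewrite (bigD1 lam0) // big1 => [|lam /andP[_ ne]].
    rewrite mxE (@thetaT_diag lam0) // mulr1 /e /= eqxx inord_val.
    have -> : inord m = c by apply: val_inj; rewrite /= inordK //; lia.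
    by rewrite addr0 subrr.
  rewrite mxE /e; case: eqP => [em|_]; last by rewrite mul0r.
  apply/eqP; rewrite mulf_eq0; apply: contraT; rewrite negb_or => /andP[_].
  move=> /thetaT_neq0 [e1 e2]; case/eqP: ne.
  by move: em e1 e2 => /= em e1 e2; apply: Lam_eq => //=; lia.
have [c ec] := IHm B' (ltnW mn) symB' B'z.
exists (fun lam => c lam + e lam); under eq_bigr do rewrite scalerDl.
by rewrite big_split /= -ec /B' subrK.
Qed.

Lemma sum_basisM (c : 'I_l + Lam l -> S) : \sum_x c x *: basisM R x =
  U *m (\sum_k c (inl k) *: etaN R k + (\sum_lam c (inr lam) *: T lam) *m U^T).
Proof.
rewrite big_sumType /= mulmxDr; congr (_ + _).
  by rewrite mulmx_sumr; apply: eq_bigr => k _; rewrite -scalemxAr.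
rewrite mulmx_suml mulmx_sumr; apply: eq_bigr => lam _.
by rewrite -scalemxAl -scalemxAr mulmxA.
Qed.

Lemma umx_trI m (A : 'M[S]_(m, l)) : A *m U^T = 0 -> A = 0.
Proof.
move/(congr1 trmx); rewrite trmx_mul trmxK trmx0 => /umx_inj.
by move/(congr1 trmx); rewrite trmxK trmx0.
Qed.

Lemma thetaU_max (A : 'M[S]_l) j :
  (forall d, A ord_max d = 0) -> (A *m U^T) ord_max j = 0.
Proof. by move=> A0; rewrite mxE big1 // => d _; rewrite A0 mul0r. Qed.

Lemma sum_etaN_max (c : 'I_l -> S) j :
  (\sum_k c k *: etaN R k) ord_max j = c j.
Proof.
rewrite summxE (bigD1 j) //= mxE etaN_max eqxx mulr1 big1 ?addr0 // => k kj.
by rewrite mxE etaN_max eq_sym (negbTE kj) mulr0.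
Qed.

(** After cancelling U, the last row reads off the coefficients of the eta_k; cancelling U^T then
    leaves a relation among the T's. *)
Lemma basisM_free (c : 'I_l + Lam l -> S) :
  \sum_x c x *: basisM R x = 0 -> forall x, c x = 0.
Proof.
rewrite sum_basisM => /umx_inj e.
have c0 j : c (inl j) = 0.
  have /matrixP/(_ ord_max j) := e; rewrite mxE sum_etaN_max thetaU_max ?addr0 ?mxE //.
  move=> d; rewrite summxE big1 // => lam _.
  by rewrite mxE thetaT_max mulr0.
move: e; rewrite big1 ?add0r => [/umx_trI/thetaT_free c0' [j|lam] //|k _].
by rewrite c0 scale0r.
Qed.

Lemma log_mx_sub m (A B : 'M[S]_(l, m)) : log_mx A -> log_mx B -> log_mx (A - B).
Proof.
move=> logA logB i j b c ij.
by rewrite !mxE !rmorphB /= logA // logB // mulrBr.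
Qed.

Lemma log_basisM (x : 'I_l + Lam l) : log_mx (basisM R x).
Proof.
case: x => [k|lam] /=; first exact/log_mxM/log_umx.
by rewrite /thetaM -mulmxA; apply/log_mxM/log_umx.
Qed.

Lemma sym_log_span (M : 'M[S]_l) :
  (U *m M)^T = U *m M -> log_mx (U *m M) -> (forall k, M ord_max k = 0) ->
  exists c : Lam l -> S, U *m M = U *m (\sum_lam c lam *: T lam) *m U^T.
Proof.
move=> symG logG Mmax; set G := U *m M in symG logG.
have logMT : log_mx M^T.
  move=> i j b c ij; rewrite !mxE.
  (* By symmetry of U M, the folded U annihilates [y], whose last entry is 0, so [fold_umx_inj]
     applies. *)
  pose y := map_mx (fold i j b) (col i M - (-1) ^+ b *: col j M).
  have y0 : y = 0.
    apply: (fold_umx_inj (b := b) ij) => [d|].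
      by rewrite !mxE !Mmax mulr0 subr0 rmorph0.
    rewrite /y -map_mxM mulmxBr -scalemxAr !colE !mulmxA -!colE -/G.
    apply/matrixP => r z; rewrite !mxE rmorphB rmorphM rmorph_sign /=.
    have GT r' : G r r' = G r' r by rewrite -[in LHS]symG mxE.
    apply/eqP; rewrite subr_eq0; apply/eqP.
    by have := logG i j b r ij; rewrite -(GT i) -(GT j) /G !mxE.
  have /matrixP/(_ c 0) := y0; rewrite !mxE rmorphB rmorphM rmorph_sign /=.
  by move/eqP; rewrite subr_eq0 => /eqP.
have [B0 e0] := log_mx_span logMT; pose B := B0^T.
have eM : M = B *m U^T by rewrite -[M]trmxK e0 trmx_mul.
have symB : B^T = B.
  apply/eqP; rewrite -subr_eq0; apply/eqP/umx_inj/umx_trI.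
  apply/eqP; rewrite mulmxBr mulmxBl subr_eq0; apply/eqP.
  move: symG; rewrite /G eM !trmx_mul !trmxK => ->.
  by rewrite mulmxA.
have Bmax d : B ord_max d = 0.
  have : row ord_max B *m U^T = 0.
    by rewrite -row_mul -eM; apply/matrixP => r z; rewrite !mxE.
  by move/umx_trI/matrixP/(_ 0 d); rewrite !mxE.
have [c ec] := thetaT_span symB Bmax.
by exists c; rewrite /G eM ec mulmxA.
Qed.

Lemma basisM_span (G : 'M[S]_l) : G^T = G -> log_mx G ->
  exists c : 'I_l + Lam l -> S, G = \sum_x c x *: basisM R x.
Proof.
move=> symG logG; have [M eM] := log_mx_span logG.
pose p k := M ord_max k.
pose E := \sum_k p k *: etaM R k.
have eE : E = U *m \sum_k p k *: etaN R k.
  by rewrite mulmx_sumr; apply: eq_bigr => k _; rewrite -scalemxAr.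
pose M' := M - \sum_k p k *: etaN R k.
have eG' : U *m M' = G - E by rewrite mulmxBr -eM eE.
have [|||c ec] := @sym_log_span M'.
- rewrite eG' linearB /= symG raddf_sum; congr (_ - _).
  by apply: eq_bigr => k _; rewrite /= linearZ /= tr_etaM.
- by rewrite eG'; apply: log_mx_sub => //; rewrite eE; apply/log_mxM/log_umx.
- by move=> k; rewrite mxE [X in _ + X]mxE sum_etaN_max subrr.
exists (fun x => match x with inl k => p k | inr lam => c lam end).
rewrite sum_basisM mulmxDr -eE mulmxA -ec eG'.
by rewrite addrC subrK.
Qed.

Lemma basisC_is_basis : is_basis (D2 (QD R l)) (@basisC R n).
Proof.
split=> [c|c|t].
- by apply/D2_log; rewrite hess_basisC; apply: log_basisM.
- move=> /(congr1 (@hess R l)); rewrite raddf_sum raddf0 => e.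
  apply: basisM_free; rewrite -[RHS]e; apply: eq_bigr => x _.
  by rewrite /= linearZ /= hess_basisC.
- move/D2_log/(basisM_span (tr_hess t)) => [c ec].
  exists c; apply: hess_inj; rewrite ec raddf_sum; apply: eq_bigr => x _.
  by rewrite /= linearZ /= hess_basisC.
Qed.
End Basis.

(** * Homogeneous components and products *)

Section HomogeneousProducts.
Local Open Scope ring_scope.
Variables (R : numFieldType) (l : nat).
Local Notation S := {mpoly R[l]}.

Lemma dhomogXU (i : 'I_l) : ('X_i : S) \is 1.-homog.
Proof. by rewrite dhomogX; apply/eqP/mdeg1. Qed.

Lemma dhomog_prodX (Q : pred 'I_l) :
  (\prod_(c < l | Q c) 'X_c : S) \is (#|Q|).-homog.
Proof.
rewrite -sum1_card; elim/big_rec2: _ => [|c d p _ hp]; first exact: dhomog1.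
exact: dhomogM (dhomogXU c) hp.
Qed.

(** Giving the indeterminate weight 2 makes the product homogeneous of weight 2 [size r]. *)
Lemma dhomog_coef_prod (r : seq S) (a d : nat) :
  {in r, forall y, y \is 2.-homog} -> (d + 2 * a = 2 * size r)%N ->
  (\prod_(y <- r) ('X - y%:P))`_a \is d.-homog.
Proof.
elim: r a d => [|y r IHr] a d hr e.
  have [-> ->] : a = 0%N /\ d = 0%N by move: e => /=; lia.
  by rewrite big_nil coef1 dhomog1.
have hy : y \is 2.-homog by apply: hr; rewrite mem_head.
have hr' : {in r, forall z, z \is 2.-homog}.
  by move=> z zr; apply: hr; rewrite inE zr orbT.
have {}IHr a' d' := IHr a' d' hr'.
rewrite big_cons mulrBl coefB coefXM coefCM; apply: rpredB.
  by case: a e => [|a] /= e; [apply: rpred0 | apply: IHr; lia].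
have [ar|ra] := leqP a (size r); last first.
  by rewrite nth_default ?mulr0 ?rpred0 // size_prod_XsubC.
have -> : d = (2 + (d - 2))%N by move: e => /=; lia.
by apply: dhomogM => //; apply: IHr; move: e => /=; lia.
Qed.

Lemma pihomogM (d e : nat) (p q : S) : q \is d.-homog ->
  pihomog mdeg e (p * q) =
  (if (d <= e)%N then pihomog mdeg (e - d) p else 0) * q.
Proof.
move=> hq; elim/mpolyind: p => [|c m p _ _ IHp].
  by rewrite mul0r !pihomog0; case: ifP; rewrite mul0r.
rewrite mulrDl !pihomogD {}IHp -scalerAl linearZ /=.
have hm : 'X_[m] * q \is (mdeg m + d).-homog.
  by apply: dhomogM => //; rewrite dhomogX.
case: leqP => [de|ed]; last first.
  by rewrite (pihomog_ne0 _ hm) ?scaler0 ?mul0r ?addr0 //; lia.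
rewrite mulrDl linearZ /= pihomogX; congr (_ + _).
case: eqVneq => [em|nm].
  by rewrite -scalerAl (_ : e = mdeg m + d)%N ?pihomog_dE // em subnK.
rewrite (pihomog_ne0 _ hm) ?scaler0 ?mul0r //.
by apply: contraNneq nm => <-; rewrite addnK.
Qed.

Lemma mcoeff0_pihomog (p : S) : p@_0%MM = (pihomog mdeg 0 p)@_0%MM.
Proof.
elim/mpolyind: p => [|c m p _ _ IHp]; first by rewrite pihomog0 mcoeff0.
rewrite pihomogD linearZ /= !mcoeffD !mcoeffZ -IHp pihomogX mcoeffX mdeg_eq0.
by case: eqVneq; rewrite ?mcoeffX ?mcoeff0 // => ->; rewrite eqxx.
Qed.
End HomogeneousProducts.

(** * Uniqueness of the degrees of a homogeneous basis *)

Section Exponents.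
Local Open Scope ring_scope.
Variables (R : realType) (l : nat).
Local Notation S := {mpoly R[l]}.

Lemma is_basis_reindex (A : nzRingType) (M : lmodType A) (N : M -> Prop)
    (I J : finType) (h : J -> I) (b : I -> M) :
  bijective h -> is_basis N b -> is_basis N (b \o h).
Proof.
move=> bh [bN bfree bspan]; have [g hK gK] := bh; split=> [j|c c0 j|x Nx].
- exact: bN.
- rewrite -(hK j); apply: (bfree (c \o g)); rewrite -[RHS]c0 (reindex h) /=; last first.
    by exists g => ? _.
  by apply: eq_bigr => i _; rewrite /= hK.
- have [c ->] := bspan x Nx; exists (c \o h); rewrite (reindex h) //=.
  by exists g => ? _.
Qed.

Lemma has_hbasis_map (N : dop2 R l -> Prop) (I : finType) (b : I -> dop2 R l)
    (dg : I -> nat) (L : seq I) :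
  is_basis N b -> (forall i, dop_homog (dg i) (b i)) ->
  uniq L -> (forall i, i \in L) -> has_hbasis N (map dg L).
Proof.
move=> bN homb uL allL; pose h (i : 'I_(size (map dg L))) : I :=
  tnth (in_tuple L) (cast_ord (size_map dg L) i).
have inj_h : injective h.
  have injt : injective (tnth (in_tuple L)) by apply/tuple_uniqP.
  by move=> i j /injt /cast_ord_inj.
have bij_h : bijective h.
  apply: inj_card_bij => //; rewrite card_ord size_map -(card_uniqP uL).
  by apply/subset_leq_card/subsetP.
exists (b \o h); split; first exact: is_basis_reindex.
move=> i; have iL : (i < size L)%N by rewrite -(size_map dg L).
rewrite (nth_map (h i)) // (_ : nth _ _ _ = h i); first exact: homb.
by rewrite [in RHS]/h (tnth_nth (h i)).
Qed.

Lemma hbasis_coef (N : dop2 R l -> Prop) (I : finType)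
    (b : I -> dop2 R l) (d : I -> nat) (t : dop2 R l) (e : nat) (c : I -> S) :
  is_basis N b -> (forall i, dop_homog (d i) (b i)) -> dop_homog e t ->
  t = \sum_i c i *: b i -> forall i, (c i)@_0%MM != 0 -> e = d i.
Proof.
move=> [_ bfree _] homb [_ homt] et i; apply: contraNeq => ne.
(* If e differs from d_i, the degree d_i part of the expansion is a relation with these
   coefficients. Freeness kills the one at i, which is the degree 0 part of c_i. *)
pose q j := if (d j <= d i)%N then pihomog mdeg (d i - d j) (c j) else 0.
have q0 : \sum_j q j *: b j = 0.
  apply/ffunP => a; have := congr1 (fun t : dop2 R l => pihomog mdeg (d i) (t a : S)) et.
  rewrite /= (pihomog_ne0 ne (homt a)) sum_ffunE raddf_sum => e0.
  rewrite sum_ffunE [RHS]ffunE [RHS]e0; apply: eq_bigr => j _; rewrite !ffunE.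
  by have [_ hj] := homb j; rewrite /= (pihomogM _ _ (hj a)).
have := bfree q q0 i; rewrite /q leqnn subnn mcoeff0_pihomog => ->.
by rewrite mcoeff0.
Qed.

(* The constant terms of the transition matrix form an invertible matrix, so
   some permutation picks nonzero constant terms, which force equal degrees. *)
Lemma hbasis_degrees (N : dop2 R l -> Prop) (m m' : nat)
    (b : 'I_m -> dop2 R l) (b' : 'I_m' -> dop2 R l) (d : 'I_m -> nat) (d' : 'I_m' -> nat) :
  is_basis N b -> is_basis N b' ->
  (forall i, dop_homog (d i) (b i)) -> (forall j, dop_homog (d' j) (b' j)) ->
  perm_eq (codom d') (codom d).
Proof.
move=> Bb Bb' homb homb'.
have [bN bfree bspan] := Bb; have [b'N b'free b'span] := Bb'.
have [A eA] := fin_all_exists (fun j => bspan _ (b'N j)).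
have [A' eA'] := fin_all_exists (fun i => b'span _ (bN i)).
(* Taking constant terms is a ring morphism, so it preserves the inverse relation between the
   transition matrices. *)
have mulI m1 m2 (b1 : 'I_m1 -> dop2 R l) (b2 : 'I_m2 -> dop2 R l) A1 A2 :
    (forall c : 'I_m1 -> S, \sum_i c i *: b1 i = 0 -> forall i, c i = 0) ->
    (forall i, b1 i = \sum_j A1 i j *: b2 j) ->
    (forall j, b2 j = \sum_i A2 j i *: b1 i) ->
    (\matrix_(i, j) (A1 i j)@_0%MM) *m (\matrix_(j, i) (A2 j i)@_0%MM) = 1%:M.
  move=> free1 e1 e2; apply/matrixP => i k.
  pose c k := \sum_j A1 i j * A2 j k - (i == k)%:R.
  have c0 : \sum_k c k *: b1 k = 0.
    under eq_bigr do rewrite scalerBl scaler_suml.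
    rewrite sumrB exchange_big /= [X in _ - X](bigD1 i) //= eqxx scale1r.
    rewrite [X in _ - (_ + X)]big1 => [|k' ki]; last by rewrite eq_sym (negbTE ki) scale0r.
    rewrite addr0 {1}[b1 i]e1; apply/eqP; rewrite subr_eq0; apply/eqP.
    apply: eq_bigr => j _; rewrite [in RHS]e2 scaler_sumr.
    by apply: eq_bigr => k' _; rewrite scalerA.
  have /eqP := free1 c c0 k; rewrite /c subr_eq0 => /eqP /(congr1 (mcoeff 0%MM)).
  rewrite raddf_sum /= !mxE -mpolyC_nat mcoeffC eqxx mulr1 => <-.
  by apply: eq_bigr => j _; rewrite !mxE rmorphM.
have AA' := mulI _ _ _ _ _ _ b'free eA eA'.
have A'A := mulI _ _ _ _ _ _ bfree eA' eA.
have mm : m = m' by apply/eqP; rewrite eqn_leq (mulmx1_min AA') (mulmx1_min A'A).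
subst m'; set B := (\matrix_(i, j) (A i j)@_0%MM) in AA'.
have : \det B != 0.
  apply/eqP => B0; have := congr1 (fun M => \det M) AA'.
  by rewrite /= det_mulmx B0 mul0r det1 => /eqP; rewrite eq_sym oner_eq0.
have [/existsP [s /forallP sB] _|/existsPn noB] :=
  boolP [exists s : 'S_m, [forall j, B j (s j) != 0]].
  have dE j : d' j = d (s j).
    by apply: (hbasis_coef Bb homb (homb' j) (eA j)); have := sB j; rewrite mxE.
  rewrite (_ : codom d' = map d (map s (enum 'I_m))); last first.
    by rewrite -map_comp; apply: eq_map.
  apply: perm_map; apply: uniq_perm; rewrite ?enum_uniq //.
    by rewrite map_inj_uniq ?enum_uniq //; apply: perm_inj.
  by move=> j; rewrite mem_enum; apply/mapP; exists (s^-1%g j); rewrite ?mem_enum ?permKV.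
(* Without such a permutation, every term of the Leibniz expansion of the determinant vanishes. *)
case/eqP; rewrite /determinant big1 // => s _.
have /forallPn [j /negPn Bj] := noB s.
by rewrite (bigD1 j) //= (eqP Bj) mul0r mulr0.
Qed.

Lemma is_exp_of_has_hbasis (N : dop2 R l -> Prop) s : has_hbasis N s -> is_exp N s.
Proof.
move=> hs; split=> // s' [b' [Bb' homb']]; have [b [Bb homb]] := hs.
have := hbasis_degrees Bb Bb' homb homb'.
have codom_nth r : codom (fun i : 'I_(size r) => nth 0%N r i) = r.
  by rewrite -[RHS](mkseq_nth 0%N) /mkseq -val_enum_ord -map_comp.
by rewrite !codom_nth.
Qed.
End Exponents.

(** * Degrees of the basis elements and their enumeration *)

Section Degrees.
Local Open Scope ring_scope.
Variables (R : realType) (n : nat).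
Local Notation l := n.+2.
Local Notation S := {mpoly R[l]}.
Local Notation U := (umx R n).
Implicit Types (i j k : 'I_l).

Definition udeg (a : nat) : nat := if a == 0%N then n.+1 else (2 * a - 1)%N.

Lemma dhomog_umx i (a : 'I_l) : U i a \is (udeg a).-homog.
Proof.
rewrite mxE /udeg -val_eqE /=; case: ifP => _.
  by have := dhomog_prodX R (predC1 i); rewrite cardC1 card_ord.
by rewrite -[X in X.-homog]mul1n; apply/dhomogMn/dhomogXU.
Qed.

Lemma dhomog_xprod : xprod R n \is l.-homog.
Proof. by have := dhomog_prodX R (@predT 'I_l); rewrite card_ord. Qed.

Lemma dhomog_hpoly k a : (a <= n.+1)%N -> (hpoly R k)`_a \is (2 * (n.+1 - a)).-homog.
Proof.
move=> an; rewrite hpoly_seq; apply: dhomog_coef_prod => [_ /mapP [c _ ->]|].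
  exact: (dhomogMn 2 (dhomogXU R c)).
by rewrite size_map -cardE cardC1 card_ord; lia.
Qed.

(** The degree is that of h_k / x_k, with h_k of degree 2l - 2, and also that of P^2 / (x_k x_i
    x_j). *)
Lemma dhomog_etaM k i j : etaM R k i j \is (2 * l - 3).-homog.
Proof.
rewrite mxE; apply: rpred_sum => a _; rewrite [etaN _ _ _ _]mxE.
case: (eqVneq j k) => [jk|jk]; case: (eqVneq a ord0) => [a0|a0] /=; rewrite ?mulr0 ?rpred0 //.
  have -> : (2 * l - 3 = udeg a + 2 * (n.+1 - a))%N.
    have {}a0 : (a : nat) != 0%N := a0.
    by rewrite /udeg (negbTE a0); have := ltn_ord a; move: a0; lia.
  by apply: dhomogM (dhomog_umx i a) _; apply: dhomog_hpoly; rewrite -ltnS.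
have -> : (2 * l - 3 = udeg a + n)%N by rewrite a0 /udeg /=; lia.
apply: dhomogM (dhomog_umx i a) _; rewrite -signr_odd mulr_sign.
have hp : \prod_(c < l | (c != k) && (c != j)) ('X_c : S) \is n.-homog.
  have := dhomog_prodX R (fun c : 'I_l => (c != k) && (c != j)).
  suff -> : #|[pred c : 'I_l | (c != k) && (c != j)]| = n by [].
  have := cardC (pred2 k j); rewrite card2 card_ord eq_sym jk /= => -[e].
  by rewrite -[RHS]e; apply: eq_card => c; rewrite !inE negb_or.
by case: ifP => _; rewrite ?opprK ?dhomogN.
Qed.

(** The Laurent polynomial s_(a,b) has degree 2a + 2b - 2; each factor P in [thetaD] adds l. *)
Definition theta_deg (a b : nat) : nat :=
  if (1 <= b)%N then (2 * a + 2 * b - 2)%N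
  else if (1 <= a)%N then (2 * a - 2 + l)%N else (2 * l - 2)%N.

Lemma dhomog_thetaM a b i j : (b <= a <= n)%N ->
  thetaM R n a b i j \is (theta_deg a b).-homog.
Proof.
case/andP=> ba an; rewrite mxE; apply: rpred_sum => d _.
rewrite [U^T _ _]mxE [(U *m _) i d]mxE mulr_suml.
apply: rpred_sum => c _; rewrite [thetaT _ _ _ _ _ _]mxE.
case: ifP => [/and3P[/eqP e bc ca]|]; last by rewrite mulr0 mul0r rpred0.
rewrite mulrAC; set t := if _ then _ else _.
pose m := if [&& b == 0, 0 < c & c < a]%N then l else 0%N.
have -> : theta_deg a b = (udeg c + udeg d + m)%N.
  rewrite /theta_deg /udeg /m; do ![case: ifP => /=]; lia.
apply: dhomogM (dhomogM (dhomog_umx i c) (dhomog_umx j d)) _.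
by rewrite /t /m; case: ifP => _; [apply: dhomog_xprod | apply: dhomog1].
Qed.

Definition basis_deg (x : 'I_l + Lam l) : nat :=
  match x with
  | inl _ => (2 * l - 3)%N
  | inr lam => theta_deg (val lam).1 (val lam).2
  end.

Lemma basisC_homog x : dop_homog (basis_deg x) (basisC R x).
Proof.
split.
  (* The elements are nonzero because they are linearly independent. *)
  have [_ bfree _] := basisC_is_basis R n.
  apply/eqP => x0; have e : \sum_y (y == x)%:R *: basisC R y = 0.
    by rewrite (bigD1 x) //= x0 scaler0 add0r big1 // => y /negbTE ->; rewrite scale0r.
  by have := bfree _ e x; rewrite eqxx => /eqP; rewrite oner_eq0.
move=> a; rewrite ffunE; apply: rpredZ; have [i [j [-> _]]] := xlistP a.
case: x => [k|lam] /=; first exact: dhomog_etaM.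
by apply: dhomog_thetaM; apply: Lam_le.
Qed.

(* In the order in which the theorem lists the degrees. *)
Definition lam_pairs : seq (nat * nat) :=
  [seq (a, b) | a <- iota 1 n, b <- iota 1 a]
  ++ [seq (a, 0%N) | a <- iota 1 n] ++ [:: (0%N, 0%N)].

Lemma mem_lam_pairs a b : ((a, b) \in lam_pairs) = (b <= a <= n)%N.
Proof.
rewrite !mem_cat inE xpair_eqE.
have -> : ((a, b) \in [seq (a, b) | a <- iota 1 n, b <- iota 1 a]) =
          (1 <= b <= a)%N && (a <= n)%N.
  apply/allpairsPdep/idP => [[a' [b' [+ + [-> ->]]]]|h].
    by rewrite !mem_iota; lia.
  by exists a, b; rewrite !mem_iota; split=> //; lia.
have -> : ((a, b) \in [seq (a, 0%N) | a <- iota 1 n]) = (b == 0%N) && (1 <= a <= n)%N.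
  apply/mapP/idP => [[a' + [-> ->]]|/andP[/eqP -> h]]; first by rewrite mem_iota; lia.
  by exists a; rewrite // mem_iota; lia.
lia.
Qed.

Lemma uniq_lam_pairs : uniq lam_pairs.
Proof.
rewrite cat_uniq allpairs_uniq_dep ?iota_uniq //=; last 2 first.
- by move=> a _; apply: iota_uniq.
- by move=> [a b] [a' b'] _ _ /= [-> ->].
rewrite cat_uniq map_inj_uniq ?iota_uniq /=; last by move=> a a' [].
rewrite orbF andbT; apply/andP; split.
  apply/hasPn => -[a b]; rewrite mem_cat inE => h.
  apply/negP => /allpairsPdep [a' [b' [_ + [_ eb]]]]; rewrite mem_iota.
  by case/orP: h => [/mapP [c _ [_ e]]|/eqP [_ e]]; lia.
by apply/negP => /mapP [a + [e]]; rewrite mem_iota; lia.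
Qed.

Lemma Lam0_le : ((ord0 : 'I_l.-1) <= (ord0 : 'I_l.-1))%N.
Proof. by []. Qed.

(** The default (0, 0) is irrelevant on [lam_pairs], where [lam_ofK] recovers both parts. *)
Definition lam_of (u : nat * nat) : Lam l :=
  insubd (exist _ (ord0 : 'I_l.-1, ord0 : 'I_l.-1) Lam0_le : Lam l) (inord u.1, inord u.2).

Lemma lam_ofK a b : (b <= a <= n)%N ->
  (val (lam_of (a, b))).1 = a :> nat /\ (val (lam_of (a, b))).2 = b :> nat.
Proof.
move=> ban; rewrite /lam_of insubdK /=; first by rewrite !inordK; lia.
by rewrite unfold_in /= !inordK; lia.
Qed.

Definition basis_idx : seq ('I_l + Lam l) :=
  map inl (enum 'I_l) ++ map (fun u => inr (lam_of u)) lam_pairs.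

Lemma mem_basis_idx x : x \in basis_idx.
Proof.
rewrite mem_cat; apply/orP; case: x => [k|lam]; [left|right]; apply/mapP.
  by exists k; rewrite ?mem_enum.
exists ((val lam).1 : nat, (val lam).2 : nat).
  by rewrite mem_lam_pairs Lam_le.
by congr inr; have [e1 e2] := lam_ofK (Lam_le lam); apply: Lam_eq.
Qed.

Lemma uniq_basis_idx : uniq basis_idx.
Proof.
rewrite cat_uniq map_inj_uniq ?enum_uniq /=; last by move=> ? ? [].
apply/andP; split; first by apply/hasPn => _ /mapP [u _ ->]; apply/mapP => -[].
rewrite map_inj_in_uniq ?uniq_lam_pairs // => -[a b] [a' b'].
rewrite !mem_lam_pairs => h h' [e].
have [e1 e2] := lam_ofK h; have [e1' e2'] := lam_ofK h'.
by congr (_, _); [rewrite -e1 -e1' e | rewrite -e2 -e2' e].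
Qed.

Lemma map_basis_deg : map basis_deg basis_idx =
  nseq l (2 * l - 3)%N
  ++ [seq (2 * a + 2 * b - 2)%N | a <- iota 1 n, b <- iota 1 a]
  ++ [seq (2 * a - 2 + l)%N | a <- iota 1 n]
  ++ [:: (2 * l - 2)%N].
Proof.
rewrite map_cat -!map_comp; congr (_ ++ _).
  set r := map _ _; have -> : r = nseq (size r) (2 * l - 3)%N.
    by apply/all_pred1P/allP => _ /mapP [k _ ->] /=.
  by congr nseq; rewrite /r size_map -enumT size_enum_ord.
transitivity (map (fun u => theta_deg u.1 u.2) lam_pairs).
  apply/eq_in_map => -[a b]; rewrite mem_lam_pairs => h /=.
  by have [-> ->] := lam_ofK h.
rewrite !map_cat map_allpairs; congr (_ ++ (_ ++ _)).
  apply/eq_in_allpairs_dep => a _ b; rewrite mem_iota /theta_deg /=.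
  by case: b.
rewrite -map_comp; apply/eq_in_map => a; rewrite mem_iota /theta_deg /=.
by case: a.
Qed.
End Degrees.

Theorem theorem5p3 (R : realType) (l : nat) (hl : (2 <= l)%N) :
  (exists C : 'I_l + Lam l -> dop2 R l,
      (forall c, frac_dop (C c) = CD R c) /\ is_basis (D2 (QD R l)) C)
  /\
  is_exp (D2 (QD R l))
    (nseq l (2 * l - 3)%N
     ++ [seq (2 * a + 2 * b - 2)%N | a <- iota 1 (l - 2), b <- iota 1 a]
     ++ [seq (2 * a - 2 + l)%N | a <- iota 1 (l - 2)]
     ++ [:: (2 * l - 2)%N]).
Proof.
case: l hl => [|[|n]] // _; split.
  exists (@basisC R n); split; first exact: frac_basisC.
  exact: basisC_is_basis.
apply: is_exp_of_has_hbasis; rewrite !subSS subn0 -map_basis_deg.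
apply: (has_hbasis_map (basisC_is_basis R n)) => [x||x].
- exact: basisC_homog.
- exact: uniq_basis_idx.
- exact: mem_basis_idx.
Qed.
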